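(* Let $\mathcal{X}$ and $\mathcal{Y}$ be sets of variables with $n$ and $m$ elements, respectively, so that $\mathcal{X}$ consists of pairwise distinct elements. Let $\lambda$ be a partition with $(m,n)$-index $k$. If $\lambda_{[n-k]} = (\lambda_1, \dots, \lambda_{n-k})$ is the $(l, n-k-l)$-overlap of $\mu$ and $\nu$ for some integer $0 \leq l \leq \min\{n-k, n\}$ and some partitions $\mu$ and $\nu$, then $$LS_{\lambda}(-\mathcal{X}; \mathcal{Y}) = \sum_{\mathcal{S}, \mathcal{T}} \frac{\varepsilon_{l, n-k-l}(\mu,\nu)\, LS_{\mu + \langle k^l \rangle}(-\mathcal{S}; \mathcal{Y})\, LS_{\nu \cup \lambda_{(n+1-k, n+2-k, \dots)}}(-\mathcal{T}; \mathcal{Y})}{\Delta(\mathcal{T}; \mathcal{S})},$$ where the sum is over all pairs of subsequences $\mathcal{S}, \mathcal{T} \subset \mathcal{X}$ of lengths $l$ and $n-l$, respectively, such that $\mathcal{S} \cup \mathcal{T}$ equals $\mathcal{X}$ up to reordering.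
   Context: Sequences are finite. Sets of variables are viewed as sequences (of elements of a field, e.g. indeterminates or complex numbers) in a fixed order; repetitions are allowed unless excluded. The union $\mathcal{A} \cup \mathcal{B}$ of two sequences is obtained by appending $\mathcal{B}$ to $\mathcal{A}$; sums and negation of sequences are elementwise. $\Delta(\mathcal{X}) = \prod_{i<j} (\mathcal{X}_i - \mathcal{X}_j)$ and $\Delta(\mathcal{X};\mathcal{Y}) = \prod_{x \in \mathcal{X}, y \in \mathcal{Y}} (x-y)$. A partition is a non-increasing sequence of non-negative integers; partitions differing only by trailing zeros are equal; its length $l(\lambda)$ is the number of positive parts. When a partition is used as a sequence of prescribed length it is padded with zeros (here $\mu$ has length exactly $l$ and $\nu$ has length exactly $n-k-l$). $\langle k^l \rangle = (k,\dots,k)$ ($l$ entries). $\lambda_{(n+1-k, n+2-k,\dots)} = (\lambda_{n+1-k}, \lambda_{n+2-k}, \dots)$. $\lambda'$ is the conjugate partition. The Ferrers diagram of $\lambda$ is the set of points $(i,j)$ with $j \ge 1$, $1 \leq i \leq \lambda_j$; by convention also $(i,0) \in \lambda$ and $(0,i) \in \lambda$ for all non-negative integers $i$. Index: the $(m,n)$-index of $\lambda$ is the largest (possibly negative) integer $k \leq \min\{m,n\}$ with $(m+1-k, n+1-k) \notin \lambda$. Schur functions: for $\mathcal{X}$ of length $n$, $\mathfrak{s}_\lambda(\mathcal{X}) = 0$ if $l(\lambda) > n$, and otherwise $\mathfrak{s}_\lambda(\mathcal{X}) = \det(x^{\lambda_j+n-j})_{x \in \mathcal{X}, 1 \le j \le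 n}/\Delta(\mathcal{X})$ (extended as a polynomial to repeated variables). Littlewood-Schur functions: $LS_\lambda(\mathcal{X};\mathcal{Y}) = \sum_{\mu,\nu} c^{\lambda}_{\mu\nu} \mathfrak{s}_\mu(\mathcal{X}) \mathfrak{s}_{\nu'}(\mathcal{Y})$ with $c^\lambda_{\mu\nu}$ the Littlewood-Richardson coefficients. Overlap: $\rho_n = (n-1,\dots,1,0)$ ($\rho_0$ is empty). For partitions $\mu,\nu$ of length at most $a$ and $b$, respectively, the $(a,b)$-overlap $\mu \star_{a,b} \nu$ is the partition (of length at most $a+b$) such that $\mu \star_{a,b}\nu + \rho_{a+b}$ equals $(\mu+\rho_a) \cup (\nu+\rho_b)$ up to reordering, if it exists; otherwise $\mu \star_{a,b}\nu = \infty$, a symbol that is not a partition. If the overlap is a partition, $\varepsilon_{a,b}(\mu,\nu)$ is the sign of the permutation sorting $(\mu+\rho_a)\cup(\nu+\rho_b)$ into the strictly decreasing sequence $\mu\star_{a,b}\nu+\rho_{a+b}$; otherwise $\varepsilon_{a,b}(\mu,\nu)=1$. *)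

(* Defs.v *)
From Stdlib Require Import ClassicalEpsilon.
From HB Require Import structures.
From mathcomp Require Import all_boot all_order all_fingroup all_algebra.
From mathcomp Require Import mpoly.

Set Implicit Arguments.
Unset Strict Implicit.
Unset Printing Implicit Defensive.

Import GRing.Theory.

Local Open Scope ring_scope.

(** * Partitions *)

(* Trailing zeros are allowed: every definition below depends on a partition
   only up to trailing zeros, parts beyond the end being read as [nth 0] does. *)
Definition is_partition (la : seq nat) : bool := sorted geq la.

Definition plength (la : seq nat) : nat := count (leq 1) la.

Definition strip (la : seq nat) : seq nat := [seq p <- la | (0 < p)%N].

(* (la_1, ..., la_a), with zeros appended if [la] has fewer than [a] terms *)
Definition firstparts (a : nat) (la : seq nat) : seq nat := mkseq (nth 0%N la) a.

Definition conj_part (la : seq nat) : seq nat :=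
  mkseq (fun i => count (ltn i) la) (nth 0%N la 0).

(* The partitions of [d], each listed once and without zero parts: a partition
   of [d] has at most [d] parts, all at most [d]. *)
Definition partitions (d : nat) : seq (seq nat) :=
  [seq strip la | la <- [seq map (@nat_of_ord d.+1) t | t : d.-tuple 'I_d.+1]
     & is_partition la && (sumn la == d)].

Definition in_ferrers (la : seq nat) (i j : int) : bool :=
  match i, j with
  | Posz i, Posz j => [|| i == 0%N, j == 0%N | (i <= nth 0 la j.-1)%N]
  | _, _ => false
  end.

Definition is_index (m n : nat) (la : seq nat) (k : int) : Prop :=
  let admissible (k : int) :=
    (k <= Order.min m%:Z n%:Z)
      && ~~ in_ferrers la (m%:Z + 1 - k) (n%:Z + 1 - k) in
  admissible k /\ (forall k' : int, admissible k' -> k' <= k).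

(* mu + <k^a> as a sequence of length [a].  Here k may be negative, but the
   value is only meaningful when mu_j + k >= 0 for all j <= a: the absolute value
   is then the identity and merely converts to [nat].  If k is the (m,n)-index of
   la, k < 0 and mu star nu = (la_1, ..., la_(n-k)), then
   mu_j >= la_(n-k) >= m - k, so that mu_j + k >= m. *)
Definition add_rect (a : nat) (mu : seq nat) (k : int) : seq nat :=
  mkseq (fun j => absz ((nth 0%N mu j)%:Z + k)%R) a.

(** * Overlap *)

(* la + rho_a *)
Definition add_rho (a : nat) (la : seq nat) : seq nat :=
  mkseq (fun j => nth 0 la j + (a - j.+1))%N a.

(* [ka] is a partition and is the (a,b)-overlap of [mu] and [nu] *)
Definition is_overlap (a b : nat) (mu nu ka : seq nat) : Prop :=
  [/\ is_partition ka, (plength ka <= a + b)%N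
    & perm_eq (add_rho (a + b) ka) (add_rho a mu ++ add_rho b nu)].

(* The pick succeeds exactly when the entries are pairwise distinct, that is
   when the overlap is a partition, and the permutation is then unique. *)
Definition overlap_sign (R : pzRingType) (a b : nat) (mu nu : seq nat) : R :=
  let u := add_rho a mu ++ add_rho b nu in
  if [pick s : 'S_(a + b) | sorted gtn [seq nth 0%N u (s i) | i <- enum 'I_(a + b)]]
  is Some s then (-1) ^+ s else 1.

(** * Schur functions *)

Definition cross_diff (R : pzRingType) (X Y : seq R) : R :=
  \prod_(x <- X) \prod_(y <- Y) (x - y).

Definition mvandermonde (n : nat) : {mpoly int[n]} :=
  \prod_(i < n) \prod_(j < n | (i < j)%N) ('X_i - 'X_j).

Definition malternant (n : nat) (la : seq nat) : {mpoly int[n]} :=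
  \det (\matrix_(i < n, j < n) ('X_i ^+ (nth 0%N la j + (n - j.+1))%N : {mpoly int[n]})).

(* The quotient alternant / Vandermonde, as a polynomial with integer
   coefficients: {mpoly int[n]} is an integral domain, so it is unique. *)
Definition schur_poly (n : nat) (la : seq nat) : {mpoly int[n]} :=
  if (plength la <= n)%N then
    epsilon (inhabits 0)
      (fun p : {mpoly int[n]} => p * mvandermonde n = malternant n la)
  else 0.

Definition schur (R : comNzRingType) (la : seq nat) (X : seq R) : R :=
  mmap intr (fun i : 'I_(size X) => X`_i) (schur_poly (size X) la).

(** * Littlewood-Schur functions *)

(* [c] gives the coefficients of s_mu s_nu on Schur functions.  Requiring the
   identity for every number of variables amounts to requiring it in the ring of
   symmetric functions, and determines [c] on the partitions of |mu| + |nu|. *)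
Definition LR_expansion (mu nu : seq nat) (c : seq nat -> int) : Prop :=
  forall n : nat,
    schur_poly n mu * schur_poly n nu =
    \sum_(la <- partitions (sumn mu + sumn nu)) c la *: schur_poly n la.

Definition LRcoef (la mu nu : seq nat) : int :=
  if sumn la == (sumn mu + sumn nu)%N then
    epsilon (inhabits (fun=> 0)) (LR_expansion mu nu) (strip la)
  else 0.

(* The sum is restricted to |mu| + |nu| = |la|, the other coefficients being 0. *)
Definition LS (R : comNzRingType) (la : seq nat) (X Y : seq R) : R :=
  \sum_(i < (sumn la).+1)
    \sum_(mu <- partitions i) \sum_(nu <- partitions (sumn la - i))
      (LRcoef la mu nu)%:~R * schur mu X * schur (conj_part nu) Y.

(* Main.v *)
(** Write H(t) = prod_y (1 + y t) / prod_x (1 + x t) = sum_r h_r t^r.  The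
    Littlewood-Schur function LS_la(-X; Y) is the Jacobi-Trudi determinant
    det (h_{la_i - i + j}), which makes sense for arbitrary integers in place of
    la_i - i and is antisymmetric in its rows.  Reordering the first n - k rows
    according to the overlap therefore costs the sign epsilon(mu, nu).  By partial
    fractions, h_r is for every r a combination over x in X of the coefficients
    of index r + n - 1 of prod_y (1 + y t) / (1 + x t), and these are geometric in
    the range where the index hypothesis places the first n - k rows.  Hence
    expanding along one such row splits off one variable x; splitting off the l
    rows of mu one after another gives the sum over (S, T).

    The determinantal formula is proved by induction on Y.  Adjoining y to Y
    removes vertical strips from la on both sides: on the determinant by
    multilinearity, on the sum of c^la_{mu nu} s_mu(X) s_nu'(Y) by the branching
    rule for s_nu' and by comparing the coefficients of s_la in
    s_mu (s_th e_r) = (s_mu s_th) e_r. *)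
Require Import Defs.
From Stdlib Require Import FunctionalExtensionality ClassicalEpsilon.
From mathcomp Require Import all_boot all_order all_fingroup all_algebra.
From mathcomp Require Import mpoly zify ring.

Set Implicit Arguments.
Unset Strict Implicit.
Unset Printing Implicit Defensive.

Import Order.TTheory GRing.Theory Num.Theory.

Local Open Scope ring_scope.

(** * Formal series and Jacobi-Trudi determinants *)

Section Series.

Variable R : comNzRingType.
Implicit Types (g : int -> R) (x y z : R) (X Y : seq R).

(* A function [int -> R] stands for a formal Laurent series in t. *)
Definition mul1p y g : int -> R := fun r => g r + y * g (r - 1).

(** Division by 1 - x t. The sum stops at [g 0], so it undoes multiplication by 1 - x t only for
    causal [g]; the value 0 at negative indices makes the result causal in every case. *)
Definition div1m x g : int -> R := fun r =>
  if r is Posz n then \sum_(i < n.+1) x ^+ i * g (n%:Z - i%:Z) else 0.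

Definition causal g := forall r, r < 0 -> g r = 0.

Definition one_series : int -> R := fun r => (r == 0)%:R.

(* prod_y (1 + y t) / prod_x (1 - x t) *)
Definition ls_series X Y := foldr mul1p (foldr div1m one_series X) Y.

Lemma causal_one : causal one_series.
Proof. by move=> r; rewrite /one_series; case: eqP => // ->. Qed.

Lemma causal_mul1p y g : causal g -> causal (mul1p y g).
Proof. by move=> cg r r0; rewrite /mul1p !cg ?mulr0 ?addr0 //; lia. Qed.

Lemma causal_div1m x g : causal (div1m x g).
Proof. by case. Qed.

Lemma causal_ls X Y : causal (ls_series X Y).
Proof.
elim: Y => [|y Y IH] /=; last exact: causal_mul1p.
by case: X => [|x X]; [exact: causal_one | exact: causal_div1m].
Qed.

Lemma div1m_rec x g r : causal g -> div1m x g r = g r + x * div1m x g (r - 1).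
Proof.
move=> cg; case: r => [[|n]|n].
- by rewrite (@causal_div1m _ _ (0 - 1)) //= big_ord1 expr0 mul1r subr0 mulr0 addr0.
- rewrite (_ : n.+1%:Z - 1 = n) /=; last by lia.
  rewrite big_ord_recl expr0 mul1r subr0; congr (_ + _).
  rewrite mulr_sumr; apply: eq_bigr => i _; rewrite mulrA -exprS.
  by congr (_ * g _); rewrite lift0; lia.
by rewrite cg // (_ : Negz n - 1 = Negz n.+1) ?mulr0 ?addr0 //; lia.
Qed.

Lemma mul1p_div1m x g : causal g -> mul1p (- x) (div1m x g) = g.
Proof.
move=> cg; apply: functional_extensionality => r.
by rewrite /mul1p div1m_rec // mulNr addrK.
Qed.

(** The coefficients of a causal series are recovered one by one from index 0 upwards. Cancelling 1
    + x t in this way reduces commutation of divisions to commutation of multiplications. *)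
Lemma mul1p_inj x g1 g2 :
  causal g1 -> causal g2 -> mul1p x g1 = mul1p x g2 -> g1 = g2.
Proof.
move=> c1 c2 e; apply: functional_extensionality => -[n|n]; last by rewrite c1 ?c2.
elim: n => [|n IH]; have := congr1 (fun f => f _) e; rewrite /mul1p.
  by move/(_ 0%Z); rewrite (c1 (0 - 1)) ?(c2 (0 - 1)) // !mulr0 !addr0.
by move/(_ n.+1%:Z); rewrite (_ : n.+1%:Z - 1 = n) ?IH => [/addIr|]; last by lia.
Qed.

Lemma mul1pC y z g : mul1p y (mul1p z g) = mul1p z (mul1p y g).
Proof. by apply: functional_extensionality => r; rewrite /mul1p; ring. Qed.

Lemma mul1p_div1mC x y g :
  causal g -> mul1p y (div1m x g) = div1m x (mul1p y g).
Proof.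
move=> cg; apply: (@mul1p_inj (- x)).
- exact/causal_mul1p/causal_div1m.
- exact: causal_div1m.
rewrite mul1p_div1m; last exact: causal_mul1p.
by rewrite mul1pC mul1p_div1m.
Qed.

Lemma div1mC x y g : causal g -> div1m x (div1m y g) = div1m y (div1m x g).
Proof.
move=> cg; apply: (@mul1p_inj (- x)); try exact: causal_div1m.
rewrite mul1p_div1m; last exact: causal_div1m.
by rewrite mul1p_div1mC ?mul1p_div1m //; exact: causal_div1m.
Qed.

Lemma ls_series_cons x X Y :
  ls_series (x :: X) Y = div1m x (ls_series X Y).
Proof.
by elim: Y => [|y Y /= ->] //; rewrite mul1p_div1mC //; exact: causal_ls.
Qed.

Lemma mul1p_ls_cons x X Y : mul1p (- x) (ls_series (x :: X) Y) = ls_series X Y.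
Proof. by rewrite ls_series_cons mul1p_div1m //; exact: causal_ls. Qed.

Lemma ls_series_perm X1 X2 Y1 Y2 :
  perm_eq X1 X2 -> perm_eq Y1 Y2 -> ls_series X1 Y1 = ls_series X2 Y2.
Proof.
move=> pX pY; have -> : ls_series X1 Y1 = ls_series X1 Y2.
  rewrite /ls_series; move: (foldr div1m _ _) => g.
  apply: (@catCA_perm_subst _ _ (fun Y => foldr mul1p g Y)) pY => s1 s2 s3.
  rewrite !foldr_cat; move: (foldr _ g s3) => h.
  elim: s1 => //= y s1 ->; elim: s2 => //= z s2 <-; exact: mul1pC.
have key s1 s2 s3 : ls_series (s1 ++ s2 ++ s3) Y2 = ls_series (s2 ++ s1 ++ s3) Y2.
  elim: s1 => //= x s1 IH; rewrite ls_series_cons IH.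
  elim: s2 {IH} => [|z s2 IH] /=; first by rewrite -ls_series_cons.
  rewrite !ls_series_cons -IH div1mC //; exact: causal_ls.
exact: (@catCA_perm_subst _ _ (fun X => ls_series X Y2)) pX.
Qed.

Lemma ls_series0 X Y : ls_series X Y 0 = 1.
Proof.
elim: Y => [|y Y IH] /=; last first.
  by rewrite -/(ls_series X Y) /mul1p IH causal_ls // mulr0 addr0.
elim: X => [|x X IH] //=.
by rewrite big_ord1 expr0 mul1r subr0.
Qed.

(* For b i = la_i - i this is the Jacobi-Trudi determinant of la. *)
Definition jt N (b : 'I_N -> int) g : R := \det (\matrix_(i < N, j < N) g (b i + j%:Z)).

Lemma eq_jt N (b1 b2 : 'I_N -> int) g : b1 =1 b2 -> jt b1 g = jt b2 g.
Proof.
by move=> e; congr (\det _); apply/matrixP => i j; rewrite !mxE e.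
Qed.

Lemma jt_alt N (b : 'I_N -> int) g i1 i2 : i1 != i2 -> b i1 = b i2 -> jt b g = 0.
Proof.
by move=> ne e; apply: (determinant_alternate ne) => j; rewrite !mxE e.
Qed.

(** Since [g] vanishes at negative indices and [g 0 = 1], the last row is (0, ..., 0, 1). This
    removes the row of a zero part. *)
Lemma jt_last N (b : 'I_N.+1 -> int) g :
  causal g -> g 0 = 1 -> b ord_max = - N%:Z ->
  jt b g = jt (fun i : 'I_N => b (widen_ord (leqnSn N) i)) g.
Proof.
move=> cg g0 bN; rewrite /jt (expand_det_row _ ord_max) big_ord_recr big1 /=.
  rewrite add0r mxE bN addNr g0 mul1r /cofactor addnn -signr_odd odd_double mul1r.
  by congr (\det _); apply/matrixP => i j; rewrite !mxE; congr (g (b _ + _));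
    try apply: val_inj; rewrite /= /bump leqNgt ltn_ord.
by move=> i _; rewrite mxE bN cg ?mul0r //=; have := ltn_ord i; lia.
Qed.

(** Multilinearity in the rows: [f] picks one summand of each row i from its own range [P i]. *)
Lemma det_row_sums N B (P : 'I_N -> pred 'I_B) (w : 'I_N -> 'I_B -> R)
    (H : 'I_N -> 'I_B -> 'I_N -> R) (A : 'M[R]_N) :
  (forall i j, A i j = \sum_(c | P i c) w i c * H i c j) ->
  \det A = \sum_(f in family P)
     (\prod_i w i (f i)) * \det (\matrix_(i < N, j < N) H i (f i) j).
Proof.
move=> eA; rewrite /determinant.
under eq_bigr => s _.
  under eq_bigr do rewrite eA.
  rewrite bigA_distr_big_dep mulr_sumr.
  over.
rewrite exchange_big /=; apply: eq_bigr => f _.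
rewrite mulr_sumr; apply: eq_bigr => s _.
rewrite big_split /= mulrCA; congr (_ * (_ * _)).
by apply: eq_bigr => i _; rewrite mxE.
Qed.

Lemma jt_expand N B (P : 'I_N -> pred 'I_B) (w : 'I_N -> 'I_B -> R)
    (b : 'I_N -> 'I_B -> int) g (A : 'M[R]_N) :
  (forall i j, A i j = \sum_(c | P i c) w i c * g (b i c + j%:Z)) ->
  \det A = \sum_(f in family P) (\prod_i w i (f i)) * jt (fun i => b i (f i)) g.
Proof. by move/det_row_sums. Qed.

End Series.

(** * Partitions *)

Section Partitions.

Implicit Types la ka mu nu : seq nat.

Lemma partP la :
  reflect (forall i j, (i <= j)%N -> (nth 0 la j <= nth 0 la i)%N) (is_partition la).
Proof.
apply: (iffP idP) => [sla i j ij | le].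
  have [/(nth_default 0%N) -> // | jn] := leqP (size la) j.
  apply: (@sorted_leq_nth _ geq _ _ 0%N la sla) => //.
  - by move=> a b c /= ba cb; exact: leq_trans cb ba.
  - exact: leqnn.
  - exact: leq_ltn_trans ij jn.
by apply/(sortedP 0%N) => i _; exact: le.
Qed.

Lemma partition_strip la : is_partition la -> is_partition (strip la).
Proof. by apply: sorted_filter => a b c /= ba cb; exact: leq_trans cb ba. Qed.

Lemma strip_gt0 la : 0%N \notin strip la.
Proof. by rewrite mem_filter. Qed.

Lemma strip_id la : 0%N \notin la -> strip la = la.
Proof.
move=> la0; apply/all_filterP/allP => x xla; rewrite lt0n.
by apply: contraNneq la0 => <-.
Qed.

Lemma size_strip la : size (strip la) = plength la.
Proof. exact: size_filter. Qed.

Lemma sumn_strip la : sumn (strip la) = sumn la.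
Proof. by elim: la => // -[|a] la /= <-. Qed.

Lemma nth_strip la i : is_partition la -> nth 0%N (strip la) i = nth 0%N la i.
Proof.
elim: la i => // a la IH i pla.
have pla' : is_partition la by exact: path_sorted pla.
case: a pla => [|a] pla /=; last by case: i => //= i; exact: IH.
have z j : nth 0%N (0%N :: la) j = 0%N.
  by apply/eqP; rewrite -leqn0; exact: (partP _ pla 0%N j).
by rewrite IH // z; exact: (z i.+1).
Qed.

Lemma partition_ext la ka :
  0%N \notin la -> 0%N \notin ka -> nth 0%N la =1 nth 0%N ka -> la = ka.
Proof.
have le s1 s2 : 0%N \notin s2 -> nth 0%N s1 =1 nth 0%N s2 -> (size s2 <= size s1)%N.
  move=> s20 e; rewrite leqNgt; apply: contraNN s20 => lt.
  by rewrite -(nth_default 0%N (leqnn (size s1))) e mem_nth.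
move=> la0 ka0 e; apply: (@eq_from_nth _ 0%N) => [|i _]; last exact: e.
by apply/eqP; rewrite eqn_leq !le // => i; rewrite e.
Qed.

(* The normal form without zero parts in which [partitions] lists partitions. *)
Definition npart la := is_partition la && (0%N \notin la).

Lemma npart_strip la : is_partition la -> npart (strip la).
Proof. by move=> pla; rewrite /npart partition_strip // strip_gt0. Qed.

Lemma plength_strip la : plength (strip la) = plength la.
Proof. by rewrite -!size_strip [strip (strip la)]strip_id // strip_gt0. Qed.

Lemma nth_plength la i : is_partition la -> (plength la <= i)%N -> nth 0%N la i = 0%N.
Proof. by move=> pla le; rewrite -nth_strip // nth_default // size_strip. Qed.

Lemma size_le_sumn la : 0%N \notin la -> (size la <= sumn la)%N.
Proof.
elim: la => //= a la IH; rewrite inE negb_or => /andP[a0 /IH]; lia.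
Qed.

Lemma le_sumn la i : (nth 0 la i <= sumn la)%N.
Proof.
elim: la i => [|a la IH] [|i] //=; first by rewrite leq_addr.
exact: leq_trans (IH i) (leq_addl _ _).
Qed.

Lemma sumn_nth la N : (size la <= N)%N -> sumn la = (\sum_(i < N) nth 0 la i)%N.
Proof.
elim: la N => [N _|a la IH [|N]] //=; first by rewrite big1 // => i _; rewrite nth_nil.
by move=> le; rewrite big_ord_recl /= (IH N).
Qed.

Lemma sumn_plength la N :
  is_partition la -> (plength la <= N)%N -> sumn la = (\sum_(i < N) nth 0 la i)%N.
Proof.
move=> pla le; rewrite -sumn_strip (@sumn_nth _ N) ?size_strip //.
by apply: eq_bigr => i _; rewrite nth_strip.
Qed.

Lemma mem_partitions d ka : (ka \in partitions d) = npart ka && (sumn ka == d).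
Proof.
apply/mapP/andP => [[la] | [/andP[pka ka0] /eqP ska]].
  rewrite mem_filter => /andP[/andP[pla /eqP <-] _] ->.
  by rewrite npart_strip // sumn_strip.
(* Padded with zeros to length [d], [ka] becomes one of the filtered tuples: having no zero parts,
   it has at most [d] parts, each at most [d]. *)
pose la := mkseq (fun i => nth 0%N ka i) d.
have szka : (size ka <= d)%N by rewrite -ska size_le_sumn.
have nla i : nth 0%N la i = nth 0%N ka i.
  have [lt|ge] := ltnP i d; first by rewrite nth_mkseq.
  by rewrite !nth_default ?size_mkseq //; exact: leq_trans ge.
have pla : is_partition la.
  by apply/partP => i j ij; rewrite !nla; exact: (partP _ pka).
have ela : strip la = ka.
  apply: partition_ext => //; first exact: strip_gt0.
  by move=> i; rewrite nth_strip.
exists la => //; rewrite mem_filter pla -sumn_strip ela ska eqxx /=.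
apply/mapP; exists [tuple inord (nth 0%N ka i) | i < d]; first by rewrite mem_enum.
apply: (@eq_from_nth _ 0%N); first by rewrite size_map size_mkseq size_tuple.
move=> i; rewrite size_mkseq => lt; rewrite nth_mkseq //.
rewrite (nth_map ord0) ?size_tuple // -[i]/(nat_of_ord (Ordinal lt)) -tnth_nth.
rewrite tnth_mktuple inordK // ltnS; apply: leq_trans (le_sumn ka i) _.
by rewrite ska.
Qed.

Lemma partitions_npart d ka : ka \in partitions d -> npart ka.
Proof. by rewrite mem_partitions => /andP[]. Qed.

Lemma uniq_partitions d : uniq (partitions d).
Proof.
rewrite map_inj_in_uniq.
  apply: filter_uniq; rewrite map_inj_uniq ?enum_uniq //.
  by move=> s t e; apply: val_inj; apply: (inj_map val_inj).
move=> s t; rewrite !mem_filter => /andP[/andP[ps _] /mapP[s' _ es]].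
move=> /andP[/andP[pt _] /mapP[t' _ et]] e.
apply: (@eq_from_nth _ 0%N); first by rewrite es et !size_map !size_tuple.
by move=> i _; rewrite -nth_strip // e nth_strip.
Qed.

Definition parts_upto D := flatten [seq partitions d | d <- iota 0 D.+1].

Lemma mem_parts_upto D ka : (ka \in parts_upto D) = npart ka && (sumn ka <= D)%N.
Proof.
apply/flattenP/andP => [[s /mapP[d]]|[nka le]].
  by rewrite mem_iota ltnS => /andP[_ le] ->; rewrite mem_partitions => /andP[? /eqP->].
exists (partitions (sumn ka)); last by rewrite mem_partitions nka eqxx.
by apply: map_f; rewrite mem_iota ltnS.
Qed.

Lemma uniq_parts_upto D : uniq (parts_upto D).
Proof.
rewrite /parts_upto; elim: D.+1 0%N => //= n IH a.
rewrite cat_uniq uniq_partitions IH andbT /=; apply/hasPn => ka.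
case/flattenP => s /mapP[d]; rewrite mem_iota => /andP[lt _] ->.
rewrite !mem_partitions => /andP[_ /eqP->].
by rewrite (gtn_eqF lt) andbF.
Qed.

Lemma big_parts_upto (V : nmodType) D (P : pred (seq nat)) (F : seq nat -> V) :
  \sum_(ka <- parts_upto D | P ka) F ka
  = \sum_(d < D.+1) \sum_(ka <- partitions d | P ka) F ka.
Proof.
rewrite big_flatten big_map.
by rewrite -(big_mkord xpredT (fun d => \sum_(ka <- partitions d | P ka) F ka))
  /index_iota subn0.
Qed.

Lemma nth_map_ord N (F : 'I_N -> nat) (i : 'I_N) :
  nth 0%N [seq F j | j <- enum 'I_N] i = F i.
Proof. by rewrite (nth_map i) ?size_enum_ord // nth_ord_enum. Qed.

Definition vals N B (f : {ffun 'I_N -> 'I_B}) : seq nat :=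
  [seq nat_of_ord (f i) | i <- enum 'I_N].

Lemma size_vals N B (f : {ffun 'I_N -> 'I_B}) : size (vals f) = N.
Proof. by rewrite size_map size_enum_ord. Qed.

Lemma nth_vals N B (f : {ffun 'I_N -> 'I_B}) (i : 'I_N) : nth 0%N (vals f) i = f i.
Proof. exact: nth_map_ord. Qed.

(** [f] maps to [strip (vals f)] bijectively from the functions with weakly decreasing values onto
    the partitions with at most [N] parts. The last hypothesis says that the list [s] and the bound
    [B] are large enough for all partitions that satisfy [P]. *)
Lemma sum_ffun_partitions (V : nmodType) N B s (P : pred (seq nat)) (F : seq nat -> V) :
  uniq s -> {in s, forall ka, npart ka} ->
  (forall ka, npart ka -> P ka -> (size ka <= N)%N ->
    (ka \in s) && all (gtn B.+1) ka) ->
  \sum_(f : {ffun 'I_N -> 'I_B.+1} | is_partition (vals f) && P (strip (vals f)))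
     F (strip (vals f))
  = \sum_(ka <- s | P ka && (size ka <= N)%N) F ka.
Proof.
move=> us ns cs; rewrite -[RHS]big_filter -[LHS]big_filter /=.
rewrite -(big_map (fun f => strip (vals f)) predT F); apply: perm_big.
apply: uniq_perm.
- rewrite map_inj_in_uniq; first exact/filter_uniq/index_enum_uniq.
  move=> f g; rewrite !mem_filter => /andP[/andP[pf _] _] /andP[/andP[pg _] _] e.
  apply/ffunP => i; apply: val_inj => /=.
  by have := congr1 (fun s => nth 0%N s i) e; rewrite !nth_strip // !nth_vals.
- exact: filter_uniq.
move=> ka; rewrite mem_filter; apply/mapP/andP => [[f]|[/andP[Pka sz] kas]].
  rewrite mem_filter => /andP[/andP[pf Pf] _] ->.
  have sz : (size (strip (vals f)) <= N)%N.
    by rewrite size_filter (leq_trans (count_size _ _)) ?size_vals.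
  by rewrite Pf sz; case/andP: (cs _ (npart_strip pf) Pf sz).
have nka := ns _ kas; have /andP[pka ka0] := nka.
have /andP[_ /allP bd] := cs _ nka Pka sz.
pose f := [ffun i : 'I_N => inord (nth 0%N ka i) : 'I_B.+1].
have nf i : nth 0%N (vals f) i = nth 0%N ka i.
  have [lt|ge] := ltnP i N; last first.
    by rewrite !nth_default ?size_vals //; exact: leq_trans ge.
  rewrite (nth_vals f (Ordinal lt)) ffunE inordK //=.
  have [lt'|ge] := ltnP i (size ka); last by rewrite nth_default.
  exact/bd/mem_nth.
have pf : is_partition (vals f).
  by apply/partP => i j ij; rewrite !nf; exact: (partP _ pka).
have ef : strip (vals f) = ka.
  apply: partition_ext => //; first exact: strip_gt0.
  by move=> i; rewrite nth_strip.
by exists f => //; rewrite mem_filter pf ef Pka mem_index_enum.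
Qed.

(** The skew diagram la / ka has at most one box in each row. Rows past both lengths are empty, so a
    finite range decides the condition. *)
Definition vstrip la ka := all (fun i => (nth 0 ka i <= nth 0 la i <= (nth 0 ka i).+1)%N)
  (iota 0 (maxn (size la) (size ka))).

(** Interlacing of rows: la / ka has at most one box in each column. *)
Definition hstrip la ka := all (fun i => (nth 0 la i.+1 <= nth 0 ka i <= nth 0 la i)%N)
  (iota 0 (maxn (size la) (size ka))).

Lemma vstripP la ka :
  reflect (forall i, (nth 0 ka i <= nth 0 la i <= (nth 0 ka i).+1)%N) (vstrip la ka).
Proof.
apply: (iffP allP) => h i; last by move=> _; exact: h.
have [lt|] := ltnP i (maxn (size la) (size ka)); first by apply: h; rewrite mem_iota.
by rewrite geq_max => /andP[l1 l2]; rewrite !nth_default.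
Qed.

Lemma hstripP la ka :
  reflect (forall i, (nth 0 la i.+1 <= nth 0 ka i <= nth 0 la i)%N) (hstrip la ka).
Proof.
apply: (iffP allP) => h i; last by move=> _; exact: h.
have [lt|] := ltnP i (maxn (size la) (size ka)); first by apply: h; rewrite mem_iota.
by rewrite geq_max => /andP[l1 l2]; rewrite !nth_default // (leq_trans l1).
Qed.

Lemma size_le_nth la N : 0%N \notin la -> nth 0%N la N = 0%N -> (size la <= N)%N.
Proof.
move=> la0 e; rewrite leqNgt; apply: contraNN la0 => lt.
by rewrite -e mem_nth.
Qed.

Lemma sub_size la ka : 0%N \notin ka ->
  (forall i, nth 0 ka i <= nth 0 la i)%N -> (size ka <= size la)%N.
Proof.
move=> ka0 le; apply: size_le_nth => //; apply/eqP.
by rewrite -leqn0 (leq_trans (le _)) // nth_default.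
Qed.

Lemma sub_sumn la ka :
  (forall i, nth 0 ka i <= nth 0 la i)%N -> (sumn ka <= sumn la)%N.
Proof.
move=> le; rewrite !(@sumn_nth _ (maxn (size la) (size ka))) ?leq_maxl ?leq_maxr //.
by apply: leq_sum => i _; exact: le.
Qed.

Lemma nth_conj la i : is_partition la -> nth 0%N (conj_part la) i = count (ltn i) la.
Proof.
move=> pla; have [lt|ge] := ltnP i (nth 0%N la 0); first by rewrite nth_mkseq.
rewrite nth_default ?size_mkseq //; apply/esym/eqP; rewrite -leqn0 leqNgt -has_count.
apply/hasPn => x /(nthP 0%N)[j _ <-]; rewrite /= -leqNgt.
exact: leq_trans (partP _ pla 0%N j _) ge.
Qed.

(** Transposition of the diagram, box by box. A part is determined by the numbers below it, so this
    symmetric form yields both the involution and the exchange of horizontal and vertical strips. *)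
Lemma conj_lt la i j : is_partition la ->
  (j < nth 0 (conj_part la) i)%N = (i < nth 0 la j)%N.
Proof.
move=> pla; rewrite nth_conj //.
elim: la j pla => [|a la IH] j pla; first by rewrite nth_nil.
have pla' : is_partition la by exact: path_sorted pla.
case: j => [|j] /=; rewrite ?nth_nil; last first.
  have := partP _ pla 0%N j.+1 isT; rewrite /= -IH // => le.
  case: (ltnP i a) => ia; first by rewrite add1n ltnS.
  apply/idP/idP => [/ltnW //|]; rewrite IH // => lt.
  by have := leq_trans lt (leq_trans le ia); rewrite ltnn.
case: (ltnP i a) => ia; first by rewrite add1n.
rewrite add0n -has_count; apply/negbTE/hasPn => x /(nthP 0%N)[j _ <-].
by rewrite /= -leqNgt; exact: leq_trans (partP _ pla 0%N j.+1 _) ia.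
Qed.

Lemma npart_conj la : is_partition la -> npart (conj_part la).
Proof.
move=> pla; apply/andP; split.
  apply/partP => i j ij; rewrite !nth_conj //; apply: sub_count => x /=.
  exact: leq_ltn_trans.
apply/(nthP 0%N) => -[i]; rewrite size_mkseq => lt.
by have := conj_lt i 0 pla; rewrite lt; case: (nth _ _ _).
Qed.

Lemma conj_partK la : npart la -> conj_part (conj_part la) = la.
Proof.
case/andP => pla la0; have /andP[pc c0] := npart_conj pla.
apply: partition_ext => // [|i]; first by case/andP: (npart_conj pc).
have e j : (j < nth 0 (conj_part (conj_part la)) i)%N = (j < nth 0 la i)%N.
  by rewrite !conj_lt.
by apply/eqP; rewrite eqn_leq leqNgt e ltnn leqNgt -e ltnn.
Qed.

Lemma sumn_conj la : is_partition la -> sumn (conj_part la) = sumn la.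
Proof.
move=> pla; rewrite (@sumn_nth _ (nth 0%N la 0)) ?size_mkseq //.
under eq_bigr do rewrite nth_conj // -sum1_count.
rewrite (exchange_big_dep xpredT) //= [RHS]sumnE (big_nth 0%N) [RHS](big_nth 0%N).
apply: eq_bigr => j _; rewrite big_ord_narrow ?sum1_card ?card_ord //.
exact: (partP _ pla 0%N j isT).
Qed.

Lemma hstrip_conj la ka : is_partition la -> is_partition ka ->
  hstrip (conj_part la) (conj_part ka) = vstrip la ka.
Proof.
move=> pla pka; apply/hstripP/vstripP => h i.
  apply/andP; split; rewrite leqNgt; apply/negP.
    rewrite -conj_lt // => lt; have /andP[_ le] := h (nth 0%N la i).
    by have := leq_trans lt le; rewrite conj_lt // ltnn.
  move=> lt; have /andP[le _] := h (nth 0%N ka i).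
  rewrite -conj_lt // in lt.
  by have := leq_trans lt le; rewrite conj_lt // ltnn.
apply/andP; split; rewrite leqNgt; apply/negP.
  rewrite conj_lt // => lt; have /andP[_ le] := h (nth 0%N (conj_part ka) i).
  by have := leq_trans lt le; rewrite ltnS -conj_lt // ltnn.
rewrite conj_lt // => lt; have /andP[le _] := h (nth 0%N (conj_part la) i).
by have := leq_trans lt le; rewrite -conj_lt // ltnn.
Qed.

Lemma perm_conj_partitions d : perm_eq [seq conj_part la | la <- partitions d] (partitions d).
Proof.
apply: uniq_perm; [rewrite map_inj_in_uniq ?uniq_partitions // | exact: uniq_partitions | ].
  by move=> la ka /partitions_npart nla /partitions_npart nka e;
     rewrite -(conj_partK nla) e conj_partK.
move=> ka; apply/mapP/idP => [[la] | ].
  rewrite !mem_partitions => /andP[/andP[pla _] /eqP <-] ->.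
  by rewrite npart_conj // sumn_conj /=.
rewrite mem_partitions => /andP[nka /eqP ska]; have /andP[pka _] := nka.
exists (conj_part ka); last by rewrite conj_partK.
by rewrite mem_partitions npart_conj // sumn_conj // ska /=.
Qed.

End Partitions.

(** * Horizontal and vertical strips *)

Definition beta (la : seq nat) N (i : 'I_N) : int := (nth 0%N la i)%:Z - i%:Z.

(** The new index s = hi - c is the number of boxes removed from a row of length [hi]. *)
Lemma big_ord_interval (V : nmodType) B lo hi (F : nat -> V) :
  (lo <= hi <= B)%N ->
  \sum_(c < B.+1 | (lo <= c <= hi)%N) F c = \sum_(s < (hi - lo).+1) F (hi - s)%N.
Proof.
move=> h.
rewrite (reindex_onto (fun s : 'I_(hi - lo).+1 => inord (hi - s) : 'I_B.+1)
                      (fun c : 'I_B.+1 => inord (hi - c))).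
  apply: eq_big => [s|s _]; last by rewrite inordK //; have := ltn_ord s; lia.
  rewrite inordK; last by have := ltn_ord s; lia.
  have -> : inord (hi - (hi - s)) = s.
    by apply: val_inj; rewrite /= inordK; have := ltn_ord s; lia.
  by rewrite eqxx andbT; have := ltn_ord s; lia.
move=> c hc; apply: val_inj => /=.
by rewrite !inordK; have := ltn_ord c; lia.
Qed.

Section JacobiTrudi.

Variable R : comNzRingType.
Implicit Types (g : int -> R) (x y : R) (la ka : seq nat).

Definition jtp la g := jt (@beta la (plength la)) g.

(** Surplus rows belong to zero parts and are removed by [jt_last]. Determinants of different
    partitions can thus be given the same number of rows. *)
Lemma jtpE N la g : causal g -> g 0 = 1 -> is_partition la -> (plength la <= N)%N ->
  jt (@beta la N) g = jtp la g.
Proof.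
move=> cg g0 pla /subnK <-; elim: (N - _)%N => [|n IH] //.
rewrite addSn jt_last //.
by rewrite /beta nth_plength ?leq_addl // sub0r.
Qed.

Lemma jtp_strip la g : causal g -> g 0 = 1 -> is_partition la ->
  jtp (strip la) g = jtp la g.
Proof.
move=> cg g0 pla; rewrite -(@jtpE (plength la)) ?partition_strip ?plength_strip //.
by apply: eq_jt => i; rewrite /beta nth_strip.
Qed.

Lemma npart_plength la : npart la -> plength la = size la.
Proof. by case/andP => _ la0; rewrite -size_strip strip_id. Qed.

(** Common end of both strip expansions. A choice [f] of one value per row that decreases is a
    partition [ka] related to [la] by [S]. Any other choice has an ascent by exactly one, so f(i+1)
    - (i+1) = f(i) - i: two rows agree and the determinant vanishes. *)
Lemma jt_family_partitions x g la (P : 'I_(size la) -> pred 'I_(sumn la).+1)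
    (S : rel (seq nat)) :
  causal g -> g 0 = 1 ->
  (forall ka, S la ka -> forall i, nth 0 ka i <= nth 0 la i)%N ->
  (forall f : {ffun 'I_(size la) -> 'I_(sumn la).+1}, is_partition (vals f) ->
     (f \in family P) = S la (strip (vals f))) ->
  (forall f : {ffun 'I_(size la) -> 'I_(sumn la).+1}, f \in family P ->
     ~~ is_partition (vals f) -> exists i : nat, (i.+1 < size la)%N /\
       nth 0%N (vals f) i.+1 = (nth 0%N (vals f) i).+1) ->
  \sum_(f in family P) (\prod_(i < size la) x ^+ (nth 0 la i - f i)%N)
     * jt (fun i : 'I_(size la) => (f i)%:Z - i%:Z) g
  = \sum_(ka <- parts_upto (sumn la) | S la ka) x ^+ (sumn la - sumn ka)%N * jtp ka g.
Proof.
move=> cg g0 sub PS bad.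
rewrite (bigID (fun f => is_partition (vals f))) /= [X in _ + X]big1 ?addr0.
  rewrite [RHS]big_seq_cond.
  rewrite [RHS](eq_bigl (fun ka => (ka \in parts_upto (sumn la)) &&
                            (S la ka && (size ka <= size la)%N))); last first.
    move=> ka; case kas: (ka \in _) => //=; case Sk: (S la ka) => //=.
    apply/esym; apply: sub_size; last exact: sub.
    by move: kas; rewrite mem_parts_upto => /andP[/andP[]].
  rewrite -[RHS]big_seq_cond -(@sum_ffun_partitions _ _ (sumn la)).
  - apply: eq_big => [f|f /andP[fP pf]].
      by case pf: (is_partition (vals f)); rewrite ?andbF ?andbT //= PS.
    have pg := PS f pf; rewrite pg in fP.
    have le i : (nth 0 (vals f) i <= nth 0 la i)%N by rewrite -nth_strip //; exact: sub.
    have szf : (plength (vals f) <= size la)%N.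
      by rewrite (leq_trans (count_size _ _)) // size_vals.
    congr (_ * _); last first.
      rewrite jtp_strip // -(@jtpE (size la)) //.
      by apply: eq_jt => i; rewrite /beta nth_vals.
    rewrite prodrXr sumnB => [|i _]; last by rewrite -nth_vals.
    rewrite -(@sumn_nth la (size la)) // sumn_strip.
    rewrite (@sumn_nth (vals f) (size la)) ?size_vals //.
    by under [in RHS]eq_bigr do rewrite nth_vals.
  - exact: uniq_parts_upto.
  - by move=> ka; rewrite mem_parts_upto => /andP[].
  move=> ka nka /sub le _; rewrite mem_parts_upto nka sub_sumn //=.
  apply/allP => _ /(nthP 0%N)[i _ <-]; rewrite /= ltnS.
  exact: leq_trans (le i) (le_sumn la i).
move=> f /andP[fP nf]; have [i [lt e]] := bad f fP nf.
have lt' : (i < size la)%N by exact: ltnW.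
rewrite (@jt_alt _ _ _ _ (Ordinal lt') (Ordinal lt)) ?mulr0 //.
  by rewrite -val_eqE /= ltn_eqF.
by move: e; rewrite (nth_vals f (Ordinal lt)) (nth_vals f (Ordinal lt')) => ->; rewrite /=; lia.
Qed.

Lemma npart_nth_gt0 la i : npart la -> (i < size la)%N -> (0 < nth 0 la i)%N.
Proof.
by case/andP => _ la0 lt; rewrite lt0n; apply: contraNneq la0 => <-; exact: mem_nth.
Qed.

Lemma not_partitionP la : ~~ is_partition la ->
  exists i, (i.+1 < size la)%N /\ (nth 0 la i < nth 0 la i.+1)%N.
Proof.
move=> npla; have /existsP[i hi] : [exists i : 'I_(size la),
    (i.+1 < size la)%N && (nth 0 la i < nth 0 la i.+1)%N].
  apply: contraNT npla => /existsPn h; apply/(sortedP 0%N) => i lt /=.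
  by have := h (Ordinal (ltnW lt)); rewrite /= lt /= -leqNgt.
by exists i; apply/andP.
Qed.

(** Multiplication by 1 + y t makes each row a sum of two: part i is kept, or lowered by one with
    weight y. *)
Lemma jtp_mul1p y g la : causal g -> g 0 = 1 -> npart la ->
  jtp la (mul1p y g) =
  \sum_(ka <- parts_upto (sumn la) | vstrip la ka) y ^+ (sumn la - sumn ka) * jtp ka g.
Proof.
move=> cg g0 nla; have /andP[pla la0] := nla.
pose P (i : 'I_(size la)) := [pred c : 'I_(sumn la).+1 | c <= nth 0 la i <= c.+1]%N.
rewrite -(@jt_family_partitions _ _ _ P) //.
- rewrite -(@jtpE (size la)) ?npart_plength //; try exact: causal_mul1p.
    apply: (@jt_expand _ _ _ P (fun (i : 'I_(size la)) (c : 'I_(sumn la).+1) =>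
        y ^+ (nth 0%N la i - c)%N)
      (fun (i : 'I_(size la)) (c : 'I_(sumn la).+1) => c%:Z - i%:Z)) => i j; rewrite mxE /beta.
    (* Positivity of the part leaves room for the lowered value among the natural numbers. *)
    have lt := npart_nth_gt0 nla (ltn_ord i).
    rewrite (eq_bigl (fun c : 'I_(sumn la).+1 => (nth 0 la i).-1 <= c <= nth 0 la i)%N);
      last by move=> c; rewrite /=; lia.
    rewrite (@big_ord_interval _ _ _ _ (fun c => y ^+ (nth 0%N la i - c)%N *
      g (c%:Z - i%:Z + j%:Z))) ?leq_pred ?le_sumn //.
    rewrite (_ : (_ - _).+1 = 2)%N; last by lia.
    rewrite big_ord_recl big_ord1 lift0 /= subn0 subnn expr0 mul1r subKn // expr1.
    by rewrite /mul1p; congr (_ + _ * g _); lia.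
  by rewrite /mul1p g0 cg ?mulr0 ?addr0.
- by move=> ka /vstripP h i; case/andP: (h i).
- move=> f pf; apply/familyP/vstripP => h i; last first.
    by have := h i; rewrite nth_strip // nth_vals.
  rewrite nth_strip //; have [lt|ge] := ltnP i (size la).
    by have := h (Ordinal lt); rewrite inE (nth_vals f (Ordinal lt)).
  by rewrite !nth_default ?size_vals.
move=> f /familyP fP /not_partitionP[i []]; rewrite size_vals => lt.
have lt' : (i < size la)%N by exact: ltnW.
have := fP (Ordinal lt); have := fP (Ordinal lt'); rewrite !inE /=.
rewrite (nth_vals f (Ordinal lt)) (nth_vals f (Ordinal lt')) /= => h1 h2 h3.
(* An ascent needs equal parts i and i+1 of which only part i is lowered, so it is an ascent by
   one. *)
exists i; split => //.
rewrite (nth_vals f (Ordinal lt)) (nth_vals f (Ordinal lt')) /=.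
have := partP _ pla i i.+1 (leqnSn i); lia.
Qed.

(** This is (1 - x^d t^d) / (1 - x t) = 1 + x t + ... + x^(d-1) t^(d-1), applied to [g]. *)
Lemma div1m_sub x g d r : causal g ->
  div1m x g r - x ^+ d * div1m x g (r - d%:Z) = \sum_(s < d) x ^+ s * g (r - s%:Z).
Proof.
move=> cg; elim: d => [|d IH]; first by rewrite big_ord0 expr0 mul1r subr0 subrr.
rewrite big_ord_recr /= -IH (div1m_rec x (r - d%:Z) cg).
rewrite (_ : r - d.+1%:Z = r - d%:Z - 1); last by lia.
by rewrite exprS; ring.
Qed.

(* Subtracting from row i the multiple x^d of row i+1, with d = la_i - la_(i+1) + 1,
   leaves only the terms of a horizontal strip. *)
Lemma jt_div1m_rows x g la N : causal g -> is_partition la -> (size la <= N)%N ->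
  jt (@beta la N) (div1m x g) =
  \det (\matrix_(i < N, j < N) \sum_(s < (nth 0 la i - nth 0 la i.+1).+1%N)
            x ^+ s * g ((nth 0%N la i)%:Z - s%:Z - i%:Z + j%:Z)).
Proof.
move=> cg pla sz.
pose d (i : 'I_N) := (nth 0 la i - nth 0 la i.+1).+1%N.
pose U : 'M[R]_N := \matrix_(i, k) ((i == k)%:R - x ^+ d i * (k == i.+1 :> nat)%:R).
have detU : \det U = 1.
  rewrite -det_tr det_trig; last first.
    apply/is_trig_mxP => i j ij; rewrite !mxE.
    rewrite -val_eqE /= gtn_eqF // ltn_eqF ?mulr0 ?subr0 //; exact: ltnW.
  by apply: big1 => i _; rewrite !mxE eqxx ltn_eqF // mulr0 subr0.
rewrite /jt -[LHS]mul1r -detU -det_mulmx; congr (\det _).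
apply/matrixP => i j; rewrite !mxE.
under eq_bigr do rewrite !mxE mulrBl.
rewrite sumrB (bigD1 i) //= eqxx mul1r big1 ?addr0; last first.
  by move=> k ki; rewrite eq_sym (negbTE ki) mul0r.
have le := partP _ pla i i.+1 (leqnSn i).
transitivity (\sum_(s < d i) x ^+ s * g (beta la i + j%:Z - s%:Z)); last first.
  by apply: eq_bigr => s _; congr (_ * g _); rewrite /beta; ring.
rewrite -div1m_sub //; congr (_ - _).
have [lt|ge] := ltnP i.+1 N.
  rewrite (bigD1 (Ordinal lt)) //= eqxx mulr1 big1 ?addr0.
    by congr (_ * div1m x g _); rewrite /beta /d /=; lia.
  by move=> k; rewrite -val_eqE /= => /negbTE ->; rewrite mulr0 mul0r.
rewrite big1 => [|k _]; last first.
  by rewrite ltn_eqF ?mulr0 ?mul0r // (leq_trans (ltn_ord k)).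
(* The last row has no successor, but there the term to be subtracted has index j - i - 1 < 0 and is
   zero anyway. *)
rewrite causal_div1m ?mulr0 // /beta /d.
rewrite (_ : nth 0%N la i.+1 = 0%N); last by rewrite nth_default // (leq_trans sz).
by have := ltn_ord j; lia.
Qed.

(** After the row operations, row i ranges over the interval from part i+1 to part i of [la].
    Consecutive intervals share only an endpoint, so every choice of values decreases. *)
Lemma jtp_div1m x g la : causal g -> g 0 = 1 -> npart la ->
  jtp la (div1m x g) =
  \sum_(ka <- parts_upto (sumn la) | hstrip la ka) x ^+ (sumn la - sumn ka) * jtp ka g.
Proof.
move=> cg g0 nla; have /andP[pla la0] := nla.
pose P (i : 'I_(size la)) :=
  [pred c : 'I_(sumn la).+1 | nth 0 la i.+1 <= c <= nth 0 la i]%N.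
rewrite -(@jt_family_partitions _ _ _ P) //.
- rewrite -(@jtpE (size la)) ?npart_plength //; try exact: causal_div1m.
    rewrite jt_div1m_rows //.
    apply: (@jt_expand _ _ _ P (fun (i : 'I_(size la)) (c : 'I_(sumn la).+1) =>
        x ^+ (nth 0%N la i - c)%N)
      (fun (i : 'I_(size la)) (c : 'I_(sumn la).+1) => c%:Z - i%:Z)) => i j; rewrite mxE.
    rewrite (@big_ord_interval _ _ _ _ (fun c => x ^+ (nth 0%N la i - c)%N *
      g (c%:Z - i%:Z + j%:Z))); last by rewrite le_sumn (partP _ pla).
    by apply: eq_bigr => s _; congr (x ^+ _ * g _); have := ltn_ord s; lia.
  by rewrite /= big_ord1 expr0 mul1r subr0.
- by move=> ka /hstripP h i; case/andP: (h i).
- move=> f pf; apply/familyP/hstripP => h i; last first.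
    by have := h i; rewrite nth_strip // nth_vals.
  rewrite nth_strip //; have [lt|ge] := ltnP i (size la).
    by have := h (Ordinal lt); rewrite inE (nth_vals f (Ordinal lt)).
  by rewrite !nth_default ?size_vals // (leq_trans ge).
move=> f /familyP fP /not_partitionP[i []]; rewrite size_vals => lt.
have lt' : (i < size la)%N by exact: ltnW.
have := fP (Ordinal lt); have := fP (Ordinal lt'); rewrite !inE /=.
rewrite (nth_vals f (Ordinal lt)) (nth_vals f (Ordinal lt')) /= => h1 h2 h3.
lia.
Qed.

End JacobiTrudi.

(** * Schur polynomials as Jacobi-Trudi determinants *)

Section Alternants.

Variable R : comNzRingType.
Implicit Types (g : int -> R) (x y : R) (la ka : seq nat) (Z W Y : seq R).

(** [ls_series [::] Z] lists the elementary symmetric functions of [Z], which vanish above degree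
    [size Z]; multiplying by the product of the 1 + z t is convolution with them. *)
Lemma foldr_mul1p_conv Z g r N : (size Z < N)%N ->
  foldr (@mul1p R) g Z r = \sum_(c < N) ls_series [::] Z c%:Z * g (r - c%:Z).
Proof.
elim: Z N r => [|z Z IH] [//|N] r /=.
  rewrite big_ord_recl /= /one_series eqxx mul1r subr0 big1 ?addr0 // => c _.
  by rewrite (_ : (_ == _) = false) ?mul0r.
rewrite ltnS -/(ls_series [::] Z) => lt; rewrite {1}/mul1p.
rewrite (IH N.+1) ?ltnS 1?ltnW // (IH N) //.
under [RHS]eq_bigr do rewrite mulrDl.
rewrite big_split /=; congr (_ + _).
rewrite big_ord_recl /= (@causal_ls _ _ _ (0 - 1)) // mulr0 mul0r add0r mulr_sumr.
apply: eq_bigr => c _; rewrite -mulrA /bump /=.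
by congr (_ * (ls_series _ _ _ * g _)); lia.
Qed.

Lemma ls_series_cancel Z W Y : ls_series (Z ++ W) (map -%R Z ++ Y) = ls_series W Y.
Proof. by elim: Z => //= z Z IH; rewrite -[RHS]IH -[RHS](mul1p_ls_cons z). Qed.

Lemma det_rev n (A : 'M[R]_n) : \det (\matrix_(i, j) A (rev_ord i) (rev_ord j)) = \det A.
Proof.
pose s : 'S_n := perm (@rev_ord_inj n).
have -> : \matrix_(i, j) A (rev_ord i) (rev_ord j) = row_perm s (col_perm s A).
  by apply/matrixP => i j; rewrite !mxE !permE.
rewrite row_permE col_permE !det_mulmx !det_perm odd_permV mulrCA -signr_addb addbb.
by rewrite mulr1.
Qed.

Definition alternant n (X : 'I_n -> R) la : R :=
  \det (\matrix_(i < n, j < n) X i ^+ (nth 0%N la j + (n - j.+1))%N).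

Lemma alternant_nil n (X : 'I_n -> R) :
  alternant X [::] = \prod_(i < n) \prod_(j < n | (i < j)%N) (X i - X j).
Proof.
(* Reversing rows and columns together costs no sign and makes the exponents increase, as in
   [Vandermonde]. *)
rewrite /alternant -det_rev -det_tr.
transitivity (\det (Vandermonde n (\row_j X (rev_ord j)))).
  congr (\det _); apply/matrixP => i j; rewrite !mxE nth_nil add0n /=.
  by congr (_ ^+ _); have := ltn_ord i; lia.
rewrite det_Vandermonde (reindex_inj rev_ord_inj) /=.
under eq_bigr do rewrite (reindex_inj rev_ord_inj) /=.
rewrite (exchange_big_dep xpredT) //=; apply: eq_bigr => i _.
apply: eq_big => [j|j _]; last by rewrite !mxE !rev_ordK.
by have := ltn_ord i; have := ltn_ord j; lia.
Qed.

(** Column k of [M] holds the coefficients of the product of 1 - X_i t over i different from k.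
    Against the series [g] all factors but 1 / (1 - X_k t) cancel, so the matrix product consists of
    powers of X_k. The empty partition, with determinant 1, then identifies the determinant of
    [M]. *)
Lemma jt_mul_alternant n (X : 'I_n -> R) la :
  jt (@beta la n) (ls_series [seq X i | i <- enum 'I_n] [::]) * alternant X [::]
  = alternant X la.
Proof.
pose g := ls_series [seq X i | i <- enum 'I_n] [::].
pose Z k := [seq X i | i <- enum 'I_n & i != k].
pose M : 'M[R]_n := \matrix_(j, k) ls_series [::] (map -%R (Z k)) (n - j.+1)%:Z.
have key ka : jt (@beta ka n) g * \det M = alternant X ka.
  rewrite /alternant -[RHS]det_tr /jt -det_mulmx; congr (\det _).
  apply/matrixP => i k; rewrite !mxE.
  have pk : perm_eq [seq X i | i <- enum 'I_n] (Z k ++ [:: X k]).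
    rewrite cats1 -map_rcons -cats1; apply: perm_map.
    have := perm_to_rem (mem_enum 'I_n k); rewrite rem_filter ?enum_uniq // => pr.
    exact: perm_trans pr (permEl (perm_catC [:: k] _)).
  have szZ : (size (map -%R (Z k)) < n)%N.
    by have := perm_size pk; rewrite size_cat addn1 (size_map X) size_enum_ord
      size_map => <-.
  transitivity (ls_series [seq X i | i <- enum 'I_n] (map -%R (Z k))
                  (nth 0%N ka i + (n - i.+1))%N%:Z).
    rewrite -[RHS]/(foldr (@mul1p R) g (map -%R (Z k)) _).
    rewrite (foldr_mul1p_conv _ _ szZ) (reindex_inj rev_ord_inj) /=.
    apply: eq_bigr => j _; rewrite !mxE mulrC /=.
    by congr (ls_series _ _ _ * g _); rewrite /beta; have := ltn_ord i; have := ltn_ord j; lia.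
  rewrite (ls_series_perm pk (perm_refl _)) -{1}(cats0 (map _ _)) ls_series_cancel /=.
  rewrite big_ord_recr /= subrr mulr1 big1 ?add0r // => c _.
  by rewrite /one_series subr_eq0 eqz_nat gtn_eqF ?mulr0.
have detM : \det M = alternant X [::].
  rewrite -key jtpE //; [|exact: causal_ls|exact: ls_series0].
  by rewrite /jtp /jt det_mx00 mul1r.
by rewrite -(key la) detM.
Qed.

(** The coefficients of the product of 1 - z t form a vector [v] with A v = 0: the product with [g]
    is the series 1, and it is read off at positive indices because all parts are positive. *)
Lemma jtp_ls_eq0 Z la : is_partition la -> (size Z < plength la)%N ->
  jtp la (ls_series Z [::]) = 0.
Proof.
move=> pla lt; rewrite /jtp; set g := ls_series Z [::].
case eN: (plength la) lt => [//|N] lt.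
pose A : 'M[R]_N.+1 := \matrix_(i, j) g (beta la i + j%:Z).
pose v : 'cV[R]_N.+1 := \col_j ls_series [::] (map -%R Z) (N - j)%N%:Z.
have Av : A *m v = 0.
  apply/matrixP => i j; rewrite !mxE.
  transitivity (foldr (@mul1p R) g (map -%R Z) (beta la i + N%:Z)).
    rewrite (@foldr_mul1p_conv _ _ _ N.+1) ?size_map // (reindex_inj rev_ord_inj) /=.
    apply: eq_bigr => c _; rewrite !mxE mulrC /=.
    by congr (ls_series _ _ _ * g _); have := ltn_ord c; lia.
  have := ls_series_cancel Z [::] [::]; rewrite !cats0 => eZ.
  rewrite -[LHS]/(ls_series Z (map -%R Z) _) eZ /= /one_series.
  have : (0 < nth 0 la i)%N.
    rewrite -nth_strip // npart_nth_gt0 ?npart_strip // size_strip eN; exact: ltn_ord.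
  by case: eqP => //; rewrite /beta; have := ltn_ord i; lia.
(* The adjugate turns A v = 0 into det(A) v = 0 over any commutative ring, and the last coordinate
   of [v] is 1. *)
have := congr1 (fun B : 'cV_N.+1 => B ord_max 0) (mulmxA (\adj A) A v).
rewrite Av mulmx0 mul_adj_mx mul_scalar_mx !mxE subnn ls_series0 mulr1 => e.
exact: esym e.
Qed.

End Alternants.

(** * Evaluation of series and determinants, and Schur polynomials *)

Section Morphisms.

Variables (A B : comNzRingType) (f : {rmorphism A -> B}).

Lemma rmorph_mul1p y (g : int -> A) : f \o mul1p y g = mul1p (f y) (f \o g).
Proof. by apply: functional_extensionality => r; rewrite /= /mul1p rmorphD rmorphM. Qed.

Lemma rmorph_div1m y (g : int -> A) : f \o div1m y g = div1m (f y) (f \o g).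
Proof.
apply: functional_extensionality => -[n|n] /=; last exact: rmorph0.
by rewrite rmorph_sum; apply: eq_bigr => i _; rewrite rmorphM rmorphXn.
Qed.

Lemma rmorph_ls X Y : f \o ls_series X Y = ls_series (map f X) (map f Y).
Proof.
elim: Y => [|y Y IH] /=; last by rewrite rmorph_mul1p IH.
elim: X => [|x X IH] /=; last by rewrite -[in RHS]IH -rmorph_div1m.
apply: functional_extensionality => r /=; exact: rmorph_nat.
Qed.

Lemma rmorph_jtp la g : f (jtp la g) = jtp la (f \o g).
Proof.
by rewrite -det_map_mx; congr (\det _); apply/matrixP => i j; rewrite !mxE.
Qed.

End Morphisms.

Definition xvars n : seq {mpoly int[n]} := [seq 'X_i | i <- enum 'I_n].

Lemma malternantE n la :
  malternant n la = alternant (fun i : 'I_n => 'X_i : {mpoly int[n]}) la.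
Proof. by []. Qed.

Lemma mvandermondeE n :
  mvandermonde n = alternant (fun i : 'I_n => 'X_i : {mpoly int[n]}) [::].
Proof. by rewrite alternant_nil. Qed.

Lemma mvandermonde_neq0 n : mvandermonde n != 0.
Proof.
apply/prodf_neq0 => i _; apply/prodf_neq0 => j ij; rewrite subr_eq0.
apply/eqP => /(congr1 (fun p : {mpoly int[n]} => p@_U_(i)%MM)).
by rewrite !mcoeffXU eqxx -val_eqE /= (gtn_eqF ij).
Qed.

(** The determinant shows that the quotient exists, so the chosen polynomial satisfies its equation;
    cancelling the non-zero Vandermonde product identifies the two. *)
Lemma schur_poly_jt n la : is_partition la -> (plength la <= n)%N ->
  schur_poly n la = jtp la (ls_series (xvars n) [::]).
Proof.
move=> pla le; rewrite /schur_poly le.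
have ex : jtp la (ls_series (xvars n) [::]) * mvandermonde n = malternant n la.
  rewrite mvandermondeE malternantE -(jt_mul_alternant _ la) jtpE ?ls_series0 //.
  exact: causal_ls.
apply: (mulIf (mvandermonde_neq0 n)); rewrite ex.
exact: (epsilon_spec (inhabits 0) (fun p => p * mvandermonde n = malternant n la)
          (ex_intro _ _ ex)).
Qed.

Lemma schur_poly_eq0 n la : (n < plength la)%N -> schur_poly n la = 0.
Proof. by rewrite ltnNge /schur_poly => /negbTE ->. Qed.

Lemma schur_polyE n la : is_partition la ->
  schur_poly n la = jtp la (ls_series (xvars n) [::]).
Proof.
move=> pla; have [le|lt] := leqP (plength la) n; first exact: schur_poly_jt.
by rewrite schur_poly_eq0 // jtp_ls_eq0 // size_map size_enum_ord.
Qed.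

Lemma schurE (R : comNzRingType) la (X : seq R) : is_partition la ->
  schur la X = jtp la (ls_series X [::]).
Proof.
move=> pla; rewrite /schur schur_polyE // rmorph_jtp rmorph_ls /=.
congr (jtp la (foldr _ _ _)).
rewrite -map_comp -[RHS](mkseq_nth 0) /mkseq -(val_enum_ord (size X)) -map_comp.
by apply: eq_map => i /=; rewrite mmapX mmap1U.
Qed.

(** * Linear independence and the Pieri rule *)

Definition rho_mnm n la : 'X_{1..n} := [multinom (nth 0 la j + (n - j.+1))%N | j < n].

(** Each term of the alternant has the exponents ka + rho_n in permuted order. Both ka + rho_n and
    la + rho_n decrease strictly, so only the identity permutation can match them. *)
Lemma malternant_coef n la ka : npart la -> npart ka ->
  (size la <= n)%N -> (size ka <= n)%N ->
  (malternant n ka)@_(rho_mnm n la) = (ka == la)%:R.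
Proof.
move=> nla nka szl szk; have /andP[pla la0] := nla; have /andP[pka ka0] := nka.
have lt mu (i j : 'I_n) : is_partition mu -> (i < j)%N ->
    (nth 0 mu j + (n - j.+1) < nth 0 mu i + (n - i.+1))%N.
  move=> pmu ij; have := partP _ pmu i j (ltnW ij).
  by have := ltn_ord j; have := ltn_ord i; lia.
have inj mu : is_partition mu ->
    injective (fun i : 'I_n => nth 0 mu i + (n - i.+1))%N.
  move=> pmu i j /= e; apply: val_inj; case: (ltngtP i j) => // h.
    by have := lt _ _ _ pmu h; rewrite e ltnn.
  by have := lt _ _ _ pmu h; rewrite e ltnn.
have eX (s : 'S_n) : \prod_i (\matrix_(i < n, j < n)
      ('X_i ^+ (nth 0%N ka j + (n - j.+1))%N : {mpoly int[n]})) i (s i)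
    = 'X_[[multinom (nth 0 ka (s j) + (n - (s j).+1))%N | j < n]].
  by rewrite mpolyXE_id; apply: eq_bigr => i _; rewrite mxE mnmE.
rewrite /malternant /determinant raddf_sum /=.
under eq_bigr do rewrite eX mulr_sign (fun_if (mcoeff _)) mcoeffN mcoeffX -mulr_sign.
rewrite (bigD1 1%g) //= odd_perm1 mul1r big1 ?addr0.
  congr (nat_of_bool _)%:R; apply/eqP/eqP => [e|->]; last first.
    by apply/mnmP => i; rewrite !mnmE perm1.
  apply: partition_ext => // i; have [li|ge] := ltnP i n; last first.
    by rewrite !nth_default // (leq_trans _ ge).
  have := congr1 (fun m : 'X_{1..n} => m (Ordinal li)) e.
  by rewrite !mnmE perm1 /= => /addIn.
move=> s s1; case: eqP => [e|]; last by rewrite mulr0.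
case/eqP: s1.
have es i : (nth 0 ka (s i) + (n - (s i).+1) = nth 0 la i + (n - i.+1))%N.
  by have := congr1 (fun m : 'X_{1..n} => m i) e; rewrite !mnmE.
have srt mu : is_partition mu ->
    sorted gtn [seq (nth 0 mu (i : 'I_n) + (n - i.+1))%N | i <- enum 'I_n].
  move=> pmu; apply/(sortedP 0%N) => i; rewrite size_map size_enum_ord => li.
  have := lt _ (Ordinal (ltnW li)) (Ordinal li) pmu (leqnn _).
  by rewrite -2!(nth_map_ord (fun i : 'I_n => nth 0 mu i + (n - i.+1))%N).
have elist : [seq (nth 0 ka (i : 'I_n) + (n - i.+1))%N | i <- enum 'I_n]
           = [seq (nth 0 la (i : 'I_n) + (n - i.+1))%N | i <- enum 'I_n].
  apply: (@irr_sorted_eq _ gtn); rewrite ?srt //.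
  - by move=> a b c /= ba cb; exact: ltn_trans cb ba.
  - by move=> a; rewrite /= ltnn.
  move=> x; apply/mapP/mapP => -[i _ ->].
    by exists ((s^-1)%g i); rewrite ?mem_enum // -es permKV.
  by exists (s i); rewrite ?mem_enum // es.
apply/permP => i; rewrite perm1; apply: (inj ka) => //; rewrite es.
have := congr1 (fun u => nth 0%N u i) elist.
by rewrite 2!nth_map_ord.
Qed.

Lemma schur_poly_mulV n la : is_partition la -> (plength la <= n)%N ->
  schur_poly n la * mvandermonde n = malternant n la.
Proof.
move=> pla le; rewrite schur_poly_jt // mvandermondeE malternantE.
rewrite -(jt_mul_alternant _ la) jtpE ?ls_series0 //; exact: causal_ls.
Qed.

(** After multiplication by the Vandermonde product, the coefficient at la + rho_n isolates [c la].
    With [d <= n] no partition of [d] has too many parts. *)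
Lemma schur_poly_free n d (c : seq nat -> int) : (d <= n)%N ->
  \sum_(la <- partitions d) c la *: schur_poly n la = 0 ->
  forall la, la \in partitions d -> c la = 0.
Proof.
move=> dn e la lad.
have sz ka : ka \in partitions d -> (size ka <= n)%N.
  rewrite mem_partitions => /andP[/andP[_ k0] /eqP kd].
  by rewrite (leq_trans (size_le_sumn k0)) // kd.
have := congr1 (fun p => (p * mvandermonde n)@_(rho_mnm n la)) e.
rewrite mul0r mcoeff0 mulr_suml raddf_sum /= (bigD1_seq la) ?uniq_partitions //=.
have nla := partitions_npart lad.
have coef ka : ka \in partitions d ->
    (c ka *: schur_poly n ka * mvandermonde n)@_(rho_mnm n la) = c ka * (ka == la)%:R.
  move=> kd; have nka := partitions_npart kd; have /andP[pka _] := nka.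
  rewrite -scalerAl mcoeffZ schur_poly_mulV ?npart_plength ?sz //.
  by rewrite malternant_coef ?sz.
rewrite coef // eqxx mulr1 big_seq_cond big1 ?addr0 // => ka /andP[kd ne].
by rewrite coef // (negbTE ne) mulr0.
Qed.

Section Pieri.

Variable R : comNzRingType.

Lemma coef_prod_linear (Z : seq R) r :
  (\prod_(x <- Z) (1 + x%:P * 'X))`_r = ls_series [::] Z r%:Z.
Proof.
elim: Z r => [|x Z IH] r; first by rewrite big_nil coef1.
rewrite big_cons mulrDl mul1r coefD -mulrA coefCM [_ * \prod_(_ <- _) _]mulrC coefMX !IH /=.
rewrite /mul1p; congr (_ + _ * _); case: r => [|r] /=; first by rewrite causal_ls.
by congr ls_series; lia.
Qed.

(** Put the factor 1 + X_i T, with T a new variable, on column i of the alternant matrix, whose rows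
    are the parts. Taken out of the columns, these factors give the elementary symmetric functions;
    expanded along the rows, they raise each part by 0 or 1. The coefficient of T^r compares the
    two. *)
Lemma alternant_pieri n (X : 'I_n -> R) la r : is_partition la -> (plength la <= n)%N ->
  ls_series [::] [seq X i | i <- enum 'I_n] r%:Z * alternant X la =
  \sum_(ka <- partitions (sumn la + r) | vstrip ka la && (size ka <= n)%N) alternant X ka.
Proof.
move=> pla le.
(* A bound for every part of [la] after raising it by one. *)
pose D := (sumn la + 1)%N.
pose P (j : 'I_n) := [pred c : 'I_D.+1 | nth 0 la j <= c <= (nth 0 la j).+1]%N.
pose A : 'M[{poly R}]_n := \matrix_(j, i)
  ((X i ^+ (nth 0%N la j + (n - j.+1))%N)%:P * (1 + (X i)%:P * 'X)).
have detA : (\det A)`_r =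
    ls_series [::] [seq X i | i <- enum 'I_n] r%:Z * alternant X la.
  have -> : A = map_mx polyC (\matrix_(i, j) X i ^+ (nth 0%N la j + (n - j.+1))%N)^T
      *m diag_mx (\row_i (1 + (X i)%:P * 'X)).
    by rewrite mul_mx_diag; apply/matrixP => i j; rewrite !mxE.
  rewrite det_mulmx det_map_mx det_tr det_diag coefCM mulrC; congr (_ * _).
  have -> : \prod_i (\row_i (1 + (X i)%:P * 'X)) 0 i =
      \prod_(x <- [seq X i | i <- enum 'I_n]) (1 + x%:P * 'X).
    by rewrite big_map big_enum; apply: eq_bigr => i _; rewrite mxE.
  exact: coef_prod_linear.
rewrite -detA (@det_row_sums _ _ _ P (fun j c => 'X^(c - nth 0%N la j))
  (fun j c i => (X i ^+ (c + (n - j.+1))%N)%:P)); last first.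
  move=> j i; rewrite mxE (@big_ord_interval _ _ _ _ (fun c => 'X^(c - nth 0%N la j) *
    (X i ^+ (c + (n - j.+1))%N)%:P)); last by have := le_sumn la j; rewrite /D; lia.
  rewrite (_ : (_ - _).+1 = 2)%N; last by lia.
  rewrite big_ord_recl big_ord1 lift0 /= subn0 subn1 /= subnn subSnn expr1 expr0 mul1r.
  by rewrite mulrDr mulr1 addSn exprS polyCM; ring.
rewrite coef_sum.
pose S ka := vstrip ka la && (sumn ka == sumn la + r)%N.
have szf (f : {ffun 'I_n -> 'I_D.+1}) : (plength (vals f) <= n)%N.
  by rewrite (leq_trans (count_size _ _)) // size_vals.
have term (f : {ffun 'I_n -> 'I_D.+1}) : f \in family P ->
    (\prod_i 'X^(f i - nth 0%N la i) *
       \det (\matrix_(i, j) (X j ^+ (f i + (n - i.+1))%N)%:P))`_r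
    = alternant X (vals f) *+ (sumn (vals f) == sumn la + r)%N.
  move=> /familyP fP; rewrite prodrXr mulrC.
  have -> : \matrix_(i, j) (X j ^+ (f i + (n - i.+1))%N)%:P =
      map_mx polyC (\matrix_(i, j) X i ^+ (nth 0%N (vals f) j + (n - j.+1))%N)^T.
    by apply/matrixP => i j; rewrite !mxE nth_vals.
  rewrite det_map_mx det_tr coefCM coefXn sumnB => [|i _]; last by case/andP: (fP i).
  rewrite -sumn_plength // (@sumn_nth (vals f) n) ?size_vals //.
  under [in RHS]eq_bigr do rewrite nth_vals.
  rewrite mulr_natr; congr (_ *+ (nat_of_bool _)).
  suff : (sumn la <= \sum_(i < n) f i)%N.
    by move: (\sum_(i < n) f i)%N => t le_t; apply/eqP/eqP; lia.
  rewrite (sumn_plength pla le); apply: leq_sum => i _.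
  by case/andP: (fP i).
rewrite (eq_bigr _ term) (bigID (fun f => is_partition (vals f))) /=.
rewrite [X in _ + X]big1 ?addr0; last first.
  (* An ascent means that parts i and i+1 are equal and only part i+1 is raised; with rho added, the
     two rows coincide. *)
  move=> f /andP[/familyP fP /not_partitionP[i []]]; rewrite size_vals => li.
  have li' : (i < n)%N by exact: ltnW.
  have := fP (Ordinal li); have := fP (Ordinal li'); rewrite !inE /=.
  rewrite (nth_vals f (Ordinal li)) (nth_vals f (Ordinal li')) /= => h1 h2 h3.
  rewrite /alternant -det_tr (@determinant_alternate _ _ _ (Ordinal li') (Ordinal li)) ?mul0rn //.
    by rewrite -val_eqE /= ltn_eqF.
  move=> k; rewrite !mxE (nth_vals f (Ordinal li)) (nth_vals f (Ordinal li')) /=.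
  congr (_ ^+ _); have := partP _ pla i i.+1 (leqnSn i); lia.
transitivity (\sum_(ka <- partitions (sumn la + r) | S ka && (size ka <= n)%N) alternant X ka);
  last first.
  rewrite big_seq_cond [RHS]big_seq_cond; apply: eq_bigl => ka.
  by rewrite /S mem_partitions; case: eqP => //=; rewrite ?andbF ?andbT.
rewrite -(@sum_ffun_partitions _ _ D) => [||ka|ka nka].
- under eq_bigr do rewrite mulrb.
  rewrite -big_mkcondr /=; apply: eq_big => [f|f].
    rewrite -andbA; case pf: (is_partition (vals f)); rewrite ?andbF //=.
    rewrite /S sumn_strip; congr (_ && _).
    apply/familyP/vstripP => h i; last first.
      by have := h i; rewrite nth_strip // nth_vals.
    rewrite nth_strip //; have [li|ge] := ltnP i n.
      by have := h (Ordinal li); rewrite inE (nth_vals f (Ordinal li)).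
    rewrite [nth 0%N (vals f) i]nth_default ?size_vals // nth_plength //.
    exact: leq_trans ge.
  case/andP=> /andP[_ pf] _; rewrite /alternant; congr (\det _).
  by apply/matrixP => i j; rewrite !mxE nth_strip.
- exact: uniq_partitions.
- exact: partitions_npart.
case/andP => /vstripP h /eqP e sz; rewrite mem_partitions nka e eqxx.
apply/allP => _ /(nthP 0%N)[i _ <-]; rewrite /= ltnS /D.
by have := h i; have := le_sumn la i; lia.
Qed.

End Pieri.

Definition elem_poly n r : {mpoly int[n]} := ls_series [::] (xvars n) r%:Z.

Lemma schur_poly_pieri n la r : is_partition la ->
  elem_poly n r * schur_poly n la =
  \sum_(ka <- partitions (sumn la + r) | vstrip ka la) schur_poly n ka.
Proof.
move=> pla; rewrite (bigID (fun ka => (size ka <= n)%N)) /= [X in _ + X]big_seq_cond.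
rewrite [X in _ + X]big1 ?addr0; last first.
  move=> ka /and3P[/partitions_npart nka _ lt].
  by rewrite schur_poly_eq0 // npart_plength // ltnNge.
(* If [la] has more than [n] parts, so has every partition that contains it, and both sides
   vanish. *)
have [le|gt] := leqP (plength la) n; last first.
  rewrite schur_poly_eq0 // mulr0 big_seq_cond big1 // => ka.
  case/and3P => /partitions_npart nka /vstripP h sz.
  suff : (plength la <= n)%N by rewrite leqNgt gt.
  rewrite -size_strip; apply: leq_trans sz; apply: sub_size; first exact: strip_gt0.
  by move=> i; rewrite nth_strip //; case/andP: (h i).
apply: (mulIf (mvandermonde_neq0 n)).
rewrite -mulrA schur_poly_mulV // mulr_suml malternantE alternant_pieri //.
rewrite big_seq_cond [RHS]big_seq_cond; apply: eq_bigr => ka.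
case/and3P => /partitions_npart nka _ sz; have /andP[pka _] := nka.
by rewrite schur_poly_mulV // npart_plength.
Qed.

(** * Littlewood-Richardson coefficients and Littlewood-Schur functions *)

(** One coefficient function must serve every number of variables, which expresses an identity in
    the ring of symmetric functions. *)
Definition spanned D (f : forall n, {mpoly int[n]}) :=
  exists c : seq nat -> int, forall n, f n = \sum_(la <- partitions D) c la *: schur_poly n la.

Lemma spanned_ext D f1 f2 : (forall n, f1 n = f2 n) -> spanned D f1 -> spanned D f2.
Proof. by move=> e [c h]; exists c => n; rewrite -e. Qed.

Lemma spanned_schur D la : la \in partitions D -> spanned D (schur_poly^~ la).
Proof.
move=> laD; exists (fun ka => (ka == la)%:R) => n.
rewrite (bigD1_seq la) ?uniq_partitions //= eqxx scale1r big1 ?addr0 // => ka.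
by move=> /negbTE ->; rewrite scale0r.
Qed.

Lemma spannedB D f1 f2 : spanned D f1 -> spanned D f2 -> spanned D (fun n => f1 n - f2 n).
Proof.
move=> [c1 h1] [c2 h2]; exists (fun la => c1 la - c2 la) => n.
by rewrite h1 h2 -sumrB; apply: eq_bigr => la _; rewrite scalerBl.
Qed.

Lemma spanned_sum D (s : seq (seq nat)) (f : seq nat -> forall n, {mpoly int[n]}) :
  {in s, forall ka, spanned D (f ka)} -> spanned D (fun n => \sum_(ka <- s) f ka n).
Proof.
elim: s => [|ka s IH] h.
  by exists (fun=> 0) => n; rewrite big_nil big1 // => la _; rewrite scale0r.
have [c1 h1] := h ka (mem_head _ _).
have [|c2 h2] := IH; first by move=> mu ms; apply: h; rewrite inE ms orbT.
exists (fun la => c1 la + c2 la) => n; rewrite big_cons h1 h2 -big_split.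
by apply: eq_bigr => la _; rewrite scalerDl.
Qed.

Lemma pieri_expansion n D r (c : seq nat -> int) :
  elem_poly n r * (\sum_(ka <- partitions D) c ka *: schur_poly n ka)
  = \sum_(la <- partitions (D + r))
      (\sum_(ka <- partitions D | vstrip la ka) c ka) *: schur_poly n la.
Proof.
rewrite mulr_sumr; under [RHS]eq_bigr do rewrite scaler_suml.
rewrite [RHS](exchange_big_dep xpredT) //=.
rewrite big_seq [RHS]big_seq; apply: eq_bigr => ka.
rewrite mem_partitions => /andP[/andP[pka _] /eqP kD].
by rewrite -scalerAr schur_poly_pieri // kD scaler_sumr.
Qed.

Lemma spanned_elem D r f : spanned D f -> spanned (D + r) (fun n => elem_poly n r * f n).
Proof.
move=> [c h]; exists (fun la => \sum_(ka <- partitions D | vstrip la ka) c ka) => n.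
by rewrite h pieri_expansion.
Qed.

Lemma schur_poly_nil n : schur_poly n [::] = 1.
Proof. by rewrite schur_polyE // /jtp /jt det_mx00. Qed.

Lemma schur_poly_strip n la : is_partition la -> schur_poly n (strip la) = schur_poly n la.
Proof.
move=> pla; rewrite !schur_polyE ?partition_strip // jtp_strip ?ls_series0 //.
exact: causal_ls.
Qed.

Lemma sub_eq_sumn la ka : (forall i, nth 0 ka i <= nth 0 la i)%N ->
  sumn ka = sumn la -> nth 0%N ka =1 nth 0%N la.
Proof.
move=> le e i; apply/eqP; rewrite eqn_leq le /=.
pose N := maxn i.+1 (maxn (size la) (size ka)).
have : (\sum_(j < N) (nth 0 la j - nth 0 ka j) == 0)%N.
  rewrite sumnB //= -!sumn_nth ?e ?subnn // /N !leq_max leqnn ?orbT //.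
have iN : (i < N)%N by rewrite leq_max leqnn.
by rewrite sum_nat_eq0 => /forallP/(_ (Ordinal iN)).
Qed.

(* s_mu is e_r s_eta, with r = l(mu) and eta = mu with its first column removed,
   minus Schur functions of partitions of the same size that have more parts. *)
Lemma spanned_mul mu nu : npart mu -> npart nu ->
  spanned (sumn mu + sumn nu) (fun n => schur_poly n mu * schur_poly n nu).
Proof.
move=> nmu nnu.
(* Outer induction on |mu|, for [eta]; inner induction on |mu| - l(mu), for the partitions of the
   same size with more parts. *)
have [d] := ubnP (sumn mu); have [e] := ubnP (sumn mu - size mu)%N.
elim: d e mu nmu => // d IHd; elim=> // e IHe mu nmu lte ltd.
case: mu nmu lte ltd => [_ _ _|a mu0].
  apply: (@spanned_ext _ (schur_poly^~ nu)) => [n|].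
    by rewrite schur_poly_nil mul1r.
  by apply: spanned_schur; rewrite mem_partitions nnu add0n eqxx.
set mu := a :: mu0 => nmu lte ltd; have /andP[pmu mu0n] := nmu.
pose eta := map predn mu.
have neta i : nth 0%N eta i = (nth 0%N mu i).-1.
  have [lt|ge] := ltnP i (size mu); first by rewrite (nth_map 0%N).
  by rewrite !nth_default ?size_map.
have peta : is_partition eta.
  apply/partP => i j ij; rewrite !neta; have := partP _ pmu i j ij.
  by case: (nth _ _ i) => [|?]; case: (nth _ _ j) => [|?].
have seta : (sumn eta + size mu = sumn mu)%N.
  rewrite (@sumn_nth _ (size mu)) ?size_map // (@sumn_nth mu (size mu)) //.
  rewrite -[X in (_ + X)%N]card_ord -sum1_card -big_split /=.
  by apply: eq_bigr => i _; rewrite neta addn1 prednK // npart_nth_gt0.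
have muP : mu \in partitions (sumn eta + size mu).
  by rewrite mem_partitions nmu seta eqxx.
have vmu : vstrip mu eta.
  by apply/vstripP => i; rewrite neta leq_pred leqSpred.
pose s := [seq ka <- partitions (sumn eta + size mu) | vstrip ka eta & ka != mu].
apply: (@spanned_ext _ (fun n => elem_poly n (size mu) *
    (schur_poly n (strip eta) * schur_poly n nu)
    - \sum_(ka <- s) schur_poly n ka * schur_poly n nu)) => [n|].
  rewrite mulrA schur_poly_strip // schur_poly_pieri //.
  rewrite -big_filter (bigD1_seq mu) ?filter_uniq ?uniq_partitions //=; last first.
    by rewrite mem_filter vmu.
  by rewrite mulrDl big_filter_cond big_filter -mulr_suml addrK.
apply: spannedB.
  rewrite -seta addnAC; apply: spanned_elem; rewrite -sumn_strip.
  apply: (IHd (sumn (strip eta)).+1); rewrite ?npart_strip ?sumn_strip //.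
    by rewrite ltnS leq_subr.
  by move: ltd seta; rewrite /mu /= => ltd; lia.
apply: spanned_sum => ka; rewrite mem_filter mem_partitions seta.
case/and3P => /andP[/vstripP v ne] nka /eqP ska; rewrite -ska.
have /andP[pka ka0] := nka; have := size_le_sumn ka0.
suff : (size mu < size ka)%N.
  move=> lt le; apply: IHe => //; last by rewrite ska.
  rewrite -ltnS; apply: leq_trans lte; rewrite ltnS ska ltn_sub2l //.
  by rewrite (leq_trans lt) // -ska.
(* With at most l(mu) rows, each at most one longer than in [eta], [ka] lies inside [mu]; equal
   sizes then force equality. *)
rewrite ltnNge; apply: contraNN ne => le; apply/eqP.
apply: partition_ext => //; apply: sub_eq_sumn => // i.
have [lt|ge] := ltnP i (size mu); last by rewrite nth_default // (leq_trans le).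
have /andP[_] := v i; rewrite neta prednK // npart_nth_gt0 //.
Qed.

Lemma LRcoefP mu nu n : npart mu -> npart nu ->
  schur_poly n mu * schur_poly n nu =
  \sum_(la <- partitions (sumn mu + sumn nu)) LRcoef la mu nu *: schur_poly n la.
Proof.
move=> nmu nnu; have ex : exists c, LR_expansion mu nu c := spanned_mul nmu nnu.
rewrite (epsilon_spec (inhabits (fun=> 0)) _ ex) big_seq [RHS]big_seq.
apply: eq_bigr => la; rewrite mem_partitions => /andP[/andP[_ la0] e].
by rewrite /LRcoef e strip_id.
Qed.

(** Compare coefficients in s_mu = s_mu s_0, using |mu| variables so that the Schur polynomials
    involved are independent. *)
Lemma LRcoef_nil la mu : npart la -> npart mu -> sumn la = sumn mu ->
  LRcoef la mu [::] = (la == mu)%:R.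
Proof.
move=> nla nmu e; apply/eqP; rewrite -subr_eq0; apply/eqP.
pose c ka := LRcoef ka mu [::] - (ka == mu)%:R.
apply: (@schur_poly_free (sumn mu) (sumn mu) c) => //; last first.
  by rewrite mem_partitions nla e eqxx.
have muP : mu \in partitions (sumn mu) by rewrite mem_partitions nmu eqxx.
have := @LRcoefP mu [::] (sumn mu) nmu isT.
rewrite schur_poly_nil mulr1 addn0 => h.
under eq_bigr do rewrite scalerBl; rewrite sumrB -h.
rewrite (bigD1_seq mu) ?uniq_partitions //= eqxx scale1r big1 ?addr0 ?subrr // => ka.
by move=> /negbTE ->; rewrite scale0r.
Qed.

(* Both sides are the coefficient of s_la in s_mu s_th e_r. *)
Lemma LRcoef_vstrip la mu th : npart la -> npart mu -> npart th ->
  (sumn mu + sumn th <= sumn la)%N ->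
  \sum_(nu <- partitions (sumn la - sumn mu) | vstrip nu th) LRcoef la mu nu =
  \sum_(ka <- partitions (sumn mu + sumn th) | vstrip la ka) LRcoef ka mu th.
Proof.
move=> nla nmu nth le; apply/eqP; rewrite -subr_eq0; apply/eqP.
set D := sumn la; pose r := (D - (sumn mu + sumn th))%N.
pose c ka := \sum_(nu <- partitions (D - sumn mu) | vstrip nu th) LRcoef ka mu nu -
  \sum_(nu <- partitions (sumn mu + sumn th) | vstrip ka nu) LRcoef nu mu th.
apply: (@schur_poly_free D D c) => //; last by rewrite mem_partitions nla eqxx.
have /andP[pth _] := nth.
have e1 : elem_poly D r * (schur_poly D mu * schur_poly D th) = \sum_(ka <- partitions D)
    (\sum_(nu <- partitions (sumn mu + sumn th) | vstrip ka nu) LRcoef nu mu th)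
      *: schur_poly D ka.
  by rewrite LRcoefP // pieri_expansion /r subnKC.
have e2 : elem_poly D r * (schur_poly D mu * schur_poly D th) = \sum_(ka <- partitions D)
    (\sum_(nu <- partitions (D - sumn mu) | vstrip nu th) LRcoef ka mu nu)
      *: schur_poly D ka.
  rewrite mulrCA schur_poly_pieri // mulr_sumr.
  rewrite (_ : sumn th + r = D - sumn mu)%N; last by rewrite /r; lia.
  under [RHS]eq_bigr do rewrite scaler_suml.
  rewrite [RHS]exchange_big /= big_seq_cond [RHS]big_seq_cond.
  apply: eq_bigr => nu /andP[nuP _]; rewrite LRcoefP ?(partitions_npart nuP) //.
  move: nuP; rewrite mem_partitions => /andP[_ /eqP ->].
  by rewrite subnKC //; lia.
by under eq_bigr do rewrite scalerBl; rewrite sumrB -e1 -e2 subrr.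
Qed.

(** * The determinantal formula for Littlewood-Schur functions *)

Section LittlewoodSchur.

Variable R : comNzRingType.
Implicit Types (X Y : seq R) (la : seq nat).

(** A new variable divides the series by 1 - y t, which removes horizontal strips from the
    conjugate, that is vertical strips from [la]. *)
Lemma schur_conj_cons la y Y : npart la ->
  schur (conj_part la) (y :: Y) =
  \sum_(d < (sumn la).+1) \sum_(ka <- partitions d | vstrip la ka)
    y ^+ (sumn la - d) * schur (conj_part ka) Y.
Proof.
move=> nla; have /andP[pla _] := nla; have nc := npart_conj pla.
have /andP[pc _] := nc.
rewrite schurE // ls_series_cons jtp_div1m ?ls_series0 //; last exact: causal_ls.
rewrite big_parts_upto sumn_conj //; apply: eq_bigr => d _.
rewrite -(perm_big _ (perm_conj_partitions d)) big_map big_seq_cond [RHS]big_seq_cond /=.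
apply: eq_big => [ka|ka /andP[]]; rewrite mem_partitions.
  by case nka: (npart ka) => //=; have /andP[pka _] := nka; rewrite hstrip_conj.
case/andP => /andP[pka _] /eqP kd _; rewrite sumn_conj // kd schurE //.
by case/andP: (npart_conj pka).
Qed.

Lemma big_triangle (V : nmodType) L (G : nat -> nat -> V) :
  \sum_(i < L.+1) \sum_(e < (L - i).+1) G i e
  = \sum_(d < L.+1) \sum_(i < d.+1) G i (d - i)%N.
Proof.
elim: L => [|L IH]; first by rewrite !big_ord1.
rewrite [RHS]big_ord_recr -IH [LHS]big_ord_recr /= [X in _ + X = _]big_ord_recr /=.
rewrite subnn big_ord0 add0r [X in _ = _ + X]big_ord_recr /= subnn addrA; congr (_ + _).
rewrite -big_split; apply: eq_bigr => i _ /=.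
by rewrite subSn -1?ltnS // big_ord_recr.
Qed.

(** Without variables in [Y], only the term with empty [nu] survives. *)
Lemma LS_nil la X : npart la -> LS la X [::] = schur la X.
Proof.
move=> nla; have /andP[pla _] := nla; have laP : la \in partitions (sumn la).
  by rewrite mem_partitions nla eqxx.
rewrite /LS big_ord_recr /= subnn big1 ?add0r => [|i _].
  rewrite (bigD1_seq la) ?uniq_partitions //= [X in _ + X]big1_seq ?addr0 => [|mu /andP[ne]].
    have P0 : [::] \in partitions 0 by rewrite mem_partitions.
    rewrite (bigD1_seq [::]) ?uniq_partitions //= LRcoef_nil // eqxx mul1r.
    rewrite [schur (conj_part _) _]schurE // {1}/jtp /jt det_mx00 mulr1.
    rewrite big1_seq ?addr0 // => nu /andP[/eqP ne].
    rewrite mem_partitions => /andP[/andP[_ n0] /eqP n1].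
    by have := size_le_sumn n0; rewrite n1 leqn0 => /nilP.
  rewrite mem_partitions => /andP[nmu /eqP e].
  rewrite big1_seq // => nu; rewrite mem_partitions => /= /andP[/andP[_ n0] /eqP n1].
  have := size_le_sumn n0; rewrite n1 leqn0 => /nilP ->.
  by rewrite LRcoef_nil // eq_sym (negbTE ne) !mul0r.
rewrite big1_seq // => mu _; rewrite big1_seq // => nu /=.
rewrite mem_partitions => /andP[/andP[pnu n0] /eqP e].
have /andP[pc c0] := npart_conj pnu.
rewrite [schur (conj_part _) _]schurE // jtp_ls_eq0 ?mulr0 //.
rewrite npart_plength ?npart_conj // lt0n size_eq0; apply/eqP => ce.
have := sumn_conj pnu; rewrite ce e /=; have := ltn_ord i; lia.
Qed.

Lemma LS_jtp_npart la X Y : npart la -> LS la X Y = jtp la (ls_series X Y).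
Proof.
elim: Y la => [|y Y IH] la nla; have /andP[pla _] := nla.
  by rewrite LS_nil // schurE.
rewrite -[ls_series _ _]/(mul1p y (ls_series X Y)) jtp_mul1p ?ls_series0 //;
  last exact: causal_ls.
rewrite big_parts_upto /LS; set L := sumn la.
(* Common form of both sides: |mu| = i, |th| = e, and [ka] of size i + e with la / ka a vertical
   strip. [LRcoef_vstrip] trades the strips nu / th for the strips la / ka. *)
pose G i e := \sum_(mu <- partitions i) \sum_(th <- partitions e)
  \sum_(ka <- partitions (i + e) | vstrip la ka)
     y ^+ (L - (i + e)) * ((LRcoef ka mu th)%:~R * schur mu X * schur (conj_part th) Y).
transitivity (\sum_(i < L.+1) \sum_(e < (L - i).+1) G i e).
  apply: eq_bigr => i _; rewrite /G [RHS]exchange_big /=.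
  rewrite big_seq [RHS]big_seq; apply: eq_bigr => mu muP.
  have nmu := partitions_npart muP.
  have /eqP smu : sumn mu == i by move: muP; rewrite mem_partitions => /andP[].
  transitivity (\sum_(e < (L - i).+1) \sum_(th <- partitions e)
    (\sum_(nu <- partitions (L - i) | vstrip nu th) LRcoef la mu nu)%:~R *
    (schur mu X * (y ^+ (L - i - e) * schur (conj_part th) Y))).
    transitivity (\sum_(nu <- partitions (L - i)) \sum_(e < (L - i).+1)
        \sum_(th <- partitions e | vstrip nu th)
        (LRcoef la mu nu)%:~R * (schur mu X * (y ^+ (L - i - e) * schur (conj_part th) Y))).
      rewrite big_seq [RHS]big_seq; apply: eq_bigr => nu nuP.
      rewrite schur_conj_cons; last exact: partitions_npart nuP.
      move: nuP; rewrite mem_partitions => /andP[_ /eqP ->].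
      rewrite mulr_sumr; apply: eq_bigr => e _; rewrite mulr_sumr.
      by apply: eq_bigr => th _; rewrite -mulrA.
    rewrite exchange_big /=; apply: eq_bigr => e _.
    rewrite (exchange_big_dep xpredT) //=; apply: eq_bigr => th _.
    move: (schur mu X * _) => t; rewrite rmorph_sum mulr_suml.
    exact: eq_bigr.
  apply: eq_bigr => e _; rewrite big_seq [RHS]big_seq; apply: eq_bigr => th thP.
  have nth := partitions_npart thP.
  have /eqP sth : sumn th == e by move: thP; rewrite mem_partitions => /andP[].
  rewrite -{1}smu LRcoef_vstrip // ?smu ?sth; last first.
    by have := ltn_ord e; have := ltn_ord i; rewrite /L; lia.
  move: (schur mu X) (schur (conj_part th) Y) => a b.
  rewrite rmorph_sum mulr_suml; apply: eq_bigr => ka _.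
  by rewrite subnDA /=; ring.
rewrite big_triangle; apply: eq_bigr => d _.
transitivity (\sum_(ka <- partitions d | vstrip la ka)
    \sum_(i < d.+1) \sum_(mu <- partitions i) \sum_(th <- partitions (d - i))
     y ^+ (L - d) * ((LRcoef ka mu th)%:~R * schur mu X * schur (conj_part th) Y)).
  rewrite [RHS]exchange_big /=; apply: eq_bigr => i _.
  rewrite [RHS]exchange_big /=; apply: eq_bigr => mu _.
  rewrite [RHS]exchange_big /=; apply: eq_bigr => th _.
  by rewrite subnKC // -ltnS.
rewrite big_seq_cond [RHS]big_seq_cond; apply: eq_bigr => ka /andP[kaP _].
rewrite -IH; last exact: partitions_npart kaP.
move: kaP; rewrite mem_partitions /LS => /andP[_ /eqP ->].
rewrite mulr_sumr; apply: eq_bigr => i _; rewrite mulr_sumr; apply: eq_bigr => mu _.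
by rewrite mulr_sumr.
Qed.

Lemma LS_strip la X Y : LS (strip la) X Y = LS la X Y.
Proof.
rewrite /LS sumn_strip; apply: eq_bigr => i _; apply: eq_bigr => mu _.
apply: eq_bigr => nu _; congr (_%:~R * _ * _).
by rewrite /LRcoef sumn_strip [strip (strip la)]strip_id // strip_gt0.
Qed.

Lemma LS_jtp la X Y : is_partition la -> LS la X Y = jtp la (ls_series X Y).
Proof.
move=> pla; rewrite -LS_strip LS_jtp_npart ?npart_strip // jtp_strip ?ls_series0 //.
exact: causal_ls.
Qed.

End LittlewoodSchur.

(** * Expansion over subsets of the variables *)

Lemma ls_series_gt (R : comNzRingType) (Y : seq R) r :
  (size Y)%:Z < r -> ls_series [::] Y r = 0.
Proof.
elim: Y r => [|y Y IH] r /= lt; first by rewrite /one_series gt_eqF.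
by rewrite -/(ls_series [::] Y) /mul1p !IH ?mulr0 ?addr0 //; lia.
Qed.

(* Adding y times each column to the next one turns the geometric row into (1, 0, ..., 0). *)
Lemma det_geometric_row (R : comNzRingType) N (b : 'I_N.+1 -> int) (g : int -> R) y :
  \det (\matrix_(i < N.+1, j < N.+1)
     (if i == ord0 then (- y) ^+ j else g (b i + j%:Z)))
  = jt (fun i : 'I_N => b (lift ord0 i) + 1) (mul1p y g).
Proof.
set A := \matrix_(i, j) _.
pose U : 'M[R]_N.+1 := \matrix_(k, j) ((k == j)%:R + y * (k.+1 == j :> nat)%:R).
have detU : \det U = 1.
  rewrite -det_tr det_trig; last first.
    apply/is_trig_mxP => i j ij; rewrite !mxE -val_eqE /= gtn_eqF //.
    by rewrite gtn_eqF ?mulr0 ?addr0 // ltnS ltnW.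
  by apply: big1 => i _; rewrite !mxE eqxx gtn_eqF // mulr0 addr0.
have AU i j : (A *m U) i j = A i j +
    (if unlift ord0 j is Some j' then y * A i (widen_ord (leqnSn N) j') else 0).
  rewrite mxE; under eq_bigr do rewrite [U _ _]mxE mulrDr.
  rewrite big_split /= (bigD1 j) //= eqxx mulr1 big1 ?addr0 => [|k /negbTE ->];
    last by rewrite mulr0.
  congr (_ + _); case: unliftP => [j'|] ->; last first.
    by rewrite big1 // => k _; rewrite !mulr0.
  rewrite (bigD1 (widen_ord (leqnSn N) j')) // lift0 /= eqxx mulr1 big1 ?addr0 1?mulrC //.
  move=> k; rewrite -val_eqE /= => /negbTE ne.
  by rewrite eqSS ne !mulr0.
rewrite -[LHS]mulr1 -detU -det_mulmx (expand_det_row _ ord0) big_ord_recl big1 ?addr0.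
  rewrite AU unlift_none addr0 mxE eqxx expr0 mul1r /cofactor expr0 mul1r.
  congr (\det _); apply/matrixP => i j; rewrite [LHS]mxE [LHS]mxE AU liftK !mxE /=.
  by rewrite /mul1p /bump /=; congr (g _ + _ * g _); lia.
move=> j _; rewrite AU liftK !mxE /= -[bump 0 j]/(j.+1) exprS mulNr addNr mul0r //.
Qed.

Section Field.

Variables (F : fieldType) (Y : seq F).
Implicit Types (x z w : F) (Z W : seq F).

(** With L the series on the left, this is (1 + z t) L - (1 + w t) L = (z - w) t L. *)
Lemma divided_difference z w W r :
  (z - w) * ls_series [:: - w, - z & W] Y r =
  ls_series (- w :: W) Y (r + 1) - ls_series (- z :: W) Y (r + 1).
Proof.
have e1 := mul1p_ls_cons (- w) (- z :: W) Y.
have p : perm_eq [:: - w, - z & W] [:: - z, - w & W].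
    exact: (permEl (perm_catCA [:: - w] [:: - z] W)).
have e2 := mul1p_ls_cons (- z) (- w :: W) Y.
rewrite -(ls_series_perm p (perm_refl Y)) in e2.
by rewrite -e1 -e2 /mul1p !opprK addrK; ring.
Qed.

(** The coefficients of prod_y (1 + y t) / (1 + x t), the contribution of a single pole. *)
Definition pole x := ls_series [:: - x] Y.

Lemma partial_fractions Z r : uniq Z -> (0 < size Z)%N ->
  ls_series [seq - x | x <- Z] Y r =
  \sum_(x <- Z) pole x (r + (size Z)%:Z - 1) / \prod_(x' <- Z | x' != x) (x' - x).
Proof.
have [k] := ubnP (size Z); elim: k Z r => // k IH [|w [|z W]] // r ltk uZ _.
  by rewrite !big_seq1 big_cons eqxx big_nil divr1 addrK.
have /and3P[] : [&& w \notin z :: W, z \notin W & uniq W] by [].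
rewrite inE negb_or => /andP[wz wW] zW uW.
have zw0 : z - w != 0 by rewrite subr_eq0 eq_sym.
have wz0 : w - z != 0 by rewrite subr_eq0.
apply: (mulfI zw0); rewrite divided_difference.
rewrite (IH (w :: W)) ?(IH (z :: W)) //= ?wW ?zW //.
rewrite !big_cons !eqxx [z == w]eq_sym [w == z](negbTE wz) /=.
have prodW x : x \notin W -> \prod_(x' <- W | x' != x) (x' - x) = \prod_(x' <- W) (x' - x).
  move=> xW; rewrite big_seq_cond [RHS]big_seq; apply: eq_bigl => x'.
  by case: (boolP (x' \in W)) => //= x'W; apply: contraNneq xW => <-.
rewrite !prodW //.
(* Removing one variable while passing from r to r + 1 leaves the index of the poles unchanged. *)
pose s := r + (size W).+2%:Z - 1.
have -> : r + 1 + (size (w :: W))%:Z - 1 = s by rewrite /s /=; lia.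
rewrite -/s opprD addrACA mulrDr mulrDr [RHS]addrA; congr (_ + _ + _).
- by rewrite invfM mulrCA mulVKf.
- by rewrite -(opprB w z) invfM mulNr mulrCA mulVKf.
(* The poles in [W] occur in both series and combine by 1/(w - x) - 1/(z - x) = (z - w) / ((w - x)(z
   - x)). *)
rewrite mulr_sumr -sumrB big_seq [RHS]big_seq; apply: eq_bigr => x xW.
have wx : w != x by apply: contraNneq wW => ->.
have zx : z != x by apply: contraNneq zW => ->.
have wx0 : w - x != 0 by rewrite subr_eq0.
have zx0 : z - x != 0 by rewrite subr_eq0.
rewrite !big_cons wx zx; move: (\prod_(_ <- _ | _) _) (pole x s) => Q a.
rewrite !invfM; move: Q^-1 => q; field.
by rewrite wx0 zx0.
Qed.

(** Multiplying by 1 + x t gives a polynomial of degree at most [size Y]; beyond that degree each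
    coefficient is -x times the previous one. *)
Lemma pole_geometric x s j : (size Y)%:Z <= s -> pole x (s + j%:Z) = (- x) ^+ j * pole x s.
Proof.
move=> le; elim: j => [|j IH]; first by rewrite addr0 expr0 mul1r.
have e := mul1p_ls_cons (- x) [::] Y.
have := ls_series_gt (_ : (size Y)%:Z < s + j.+1%:Z); rewrite -e opprK /mul1p.
rewrite (_ : s + j.+1%:Z - 1 = s + j%:Z); last by lia.
rewrite -/(pole x _) -/(pole x _) IH => /(_ _)/eqP; rewrite addr_eq0 => h.
by rewrite (eqP (h _)) ?exprS; [ring | lia].
Qed.

End Field.

Section SubsetExpansion.

Variables (F : fieldType) (Y : seq F) (n : nat) (X : 'I_n -> F).
Hypothesis injX : injective X.
Implicit Types (A D : {set 'I_n}).

Definition ls_set D := ls_series [seq - X i | i <- enum D] Y.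

Lemma partial_fractions_set D r : D != set0 ->
  ls_set D r = \sum_(x in D) pole Y (X x) (r + #|D|%:Z - 1)
                  / \prod_(x' in D :\ x) (X x' - X x).
Proof.
move=> D0; pose Z := [seq X i | i <- enum D].
have uZ : uniq Z by rewrite map_inj_uniq ?enum_uniq.
have szZ : size Z = #|D| by rewrite size_map -cardE.
rewrite /ls_set (map_comp -%R X) -/Z partial_fractions //; last first.
  by rewrite szZ card_gt0.
rewrite szZ big_map big_enum /=; apply: eq_bigr => x _; congr (_ / _).
rewrite big_map big_enum_cond; apply: eq_bigl => x'.
by rewrite !inE (inj_eq injX) andbC.
Qed.

Lemma mul1p_ls_set D x : x \in D -> mul1p (X x) (ls_set D) = ls_set (D :\ x).
Proof.
move=> xD; have p : perm_eq [seq - X i | i <- enum D]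
    (- X x :: [seq - X i | i <- enum (D :\ x)]).
  apply: (perm_map (fun i => - X i) (t := x :: enum (D :\ x))).
  apply: uniq_perm => /=; rewrite ?enum_uniq //.
    by rewrite mem_enum !inE eqxx.
  by move=> i; rewrite inE !mem_enum !inE; case: eqVneq => [->|].
by rewrite /ls_set (ls_series_perm p (perm_refl _)) -[X in mul1p X]opprK mul1p_ls_cons.
Qed.

(** Partial fractions write the first row as a combination over x in [D] of geometric rows of ratio
    -X x. [det_geometric_row] then removes that row and, with it, the variable x. *)
Lemma jt_peel D N (b : 'I_N.+1 -> int) : (size Y)%:Z <= b ord0 + #|D|%:Z - 1 ->
  jt b (ls_set D) = \sum_(x in D)
    pole Y (X x) (b ord0 + #|D|%:Z - 1) / \prod_(x' in D :\ x) (X x' - X x)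
    * jt (fun i : 'I_N => b (lift ord0 i) + 1) (ls_set (D :\ x)).
Proof.
move=> le.
have row0 (j : nat) : ls_set D (b ord0 + j%:Z) = \sum_(x in D)
    pole Y (X x) (b ord0 + #|D|%:Z - 1) / \prod_(x' in D :\ x) (X x' - X x) * (- X x) ^+ j.
  have [D0|D0] := eqVneq D set0; last first.
    rewrite partial_fractions_set //; apply: eq_bigr => x _.
    rewrite (_ : _ + _ - 1 = b ord0 + #|D|%:Z - 1 + j%:Z); last by lia.
    by rewrite pole_geometric // -[LHS]mulrA mulrC.
  (* Without variables the series is a polynomial, and the bound places the whole row above its
     degree. *)
  rewrite D0 big_set0 /ls_set enum_set0 /= ls_series_gt //.
  move: le; rewrite D0 cards0 addr0; move: (b ord0) (size Y) => c p; lia.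
rewrite [LHS](expand_det_row _ ord0).
under eq_bigr do rewrite mxE row0 mulr_suml.
rewrite exchange_big /=; apply: eq_bigr => x xD.
rewrite -mul1p_ls_set // -det_geometric_row (expand_det_row _ ord0) mulr_sumr.
apply: eq_bigr => j _; rewrite mxE eqxx [RHS]mulrA; congr (_ * _).
rewrite /cofactor; congr (_ * \det _); apply/matrixP => i k; rewrite !mxE.
by rewrite eq_sym (negbTE (neq_lift _ _)).
Qed.

(** Each peeling raises the remaining labels by one and removes one variable, so label plus number
    of variables is invariant; this accounts for both shifts. By induction on [l], the first row is
    peeled off and the subset splits the remaining variables. *)
Lemma jt_split l N D (b : 'I_(l + N) -> int) :
  (forall i : 'I_l, (size Y)%:Z <= b (lshift N i) + #|D|%:Z - 1) ->
  jt b (ls_set D) = \sum_(A : {set 'I_n} | (A \subset D) && (#|A| == l))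
    jt (fun i : 'I_l => b (lshift N i) + #|D|%:Z - l%:Z) (ls_set A)
    * jt (fun i : 'I_N => b (rshift l i) + l%:Z) (ls_set (D :\: A))
    / \prod_(t in D :\: A) \prod_(s in A) (X t - X s).
Proof.
elim: l N D b => [|l IH] N D b le.
  rewrite (big_pred1 set0) => [|A]; last first.
    by rewrite cards_eq0 /=; case: eqVneq => [->|]; rewrite ?sub0set ?andbF.
  rewrite {2}/jt det_mx00 mul1r setD0 big1 ?divr1 => [|t _]; last by rewrite big_set0.
  by apply: eq_jt => i; rewrite addr0; congr (b _); apply: val_inj.
have e0 : b (lshift N ord0) = b ord0 by congr b; apply: val_inj.
have eL (i : 'I_l) : b (lshift N (lift ord0 i)) = b (lift ord0 (lshift N i)).
  by congr b; apply: val_inj.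
have eR (i : 'I_N) : b (rshift l.+1 i) = b (lift ord0 (rshift l i)).
  by congr b; apply: val_inj.
have le0 : (size Y)%:Z <= b ord0 + #|D|%:Z - 1 by rewrite -e0.
rewrite jt_peel //.
pose b1 (i : 'I_(l + N)) := b (lift ord0 i) + 1.
(* The factors X x' - X x with x' outside [A] have moved into the double product, where x joins
   [A]. *)
pose H x A := pole Y (X x) (b ord0 + #|D|%:Z - 1)
   / \prod_(x' in A) (X x' - X x)
   * jt (fun i : 'I_l => b1 (lshift N i) + #|D|%:Z - 1 - l%:Z) (ls_set A)
   * jt (fun i : 'I_N => b1 (rshift l i) + l%:Z) (ls_set ((D :\ x) :\: A))
   / \prod_(t in (D :\ x) :\: A) \prod_(s in x |: A) (X t - X s).
transitivity (\sum_(x in D) \sum_(A : {set 'I_n} | (A \subset D :\ x) && (#|A| == l)) H x A).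
  apply: eq_bigr => x xD.
  have cD : #|D|%:Z = #|D :\ x|%:Z + 1 by rewrite (cardsD1 x D) xD; lia.
  rewrite -/b1 IH => [|i]; last first.
    by have := le (lift ord0 i); rewrite eL /b1 cD; lia.
  rewrite mulr_sumr; apply: eq_bigr => A /andP[sA _]; rewrite /H.
  have xA : x \notin A.
    by apply/negP => /(subsetP sA); rewrite !inE eqxx.
  rewrite (big_setID A) /= (setIidPr sA).
  under [X in _ = _ / X]eq_bigr do rewrite big_setU1 //=.
  rewrite big_split /= !invfM.
  rewrite (@eq_jt _ _ (fun i : 'I_l => b1 (lshift N i) + #|D|%:Z - 1 - l%:Z)
    (fun i : 'I_l => b1 (lshift N i) + #|D :\ x|%:Z - l%:Z)); last first.
    by move=> i; rewrite cD; lia.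
  ring.
(* An element x with an l-subset of the rest is an (l+1)-subset with a marked element; summing over
   the mark undoes a peeling in the factor over [A]. *)
transitivity (\sum_(A : {set 'I_n} | (A \subset D) && (#|A| == l.+1)) \sum_(x in A) H x (A :\ x)).
  rewrite (exchange_big_dep (mem D)) /=; last first.
    by move=> A x /andP[/subsetP sA _]; exact: sA.
  apply: eq_bigr => x xD.
  rewrite [RHS](reindex_onto (fun A => x |: A) (fun A => A :\ x)) /=; last first.
    by move=> A /andP[_ xA]; rewrite setD1K.
  apply: eq_big => [A|A /andP[sA _]].
    rewrite subsetD1 subUset sub1set xD /= setU11 andbT.
    have [xA|xA] := boolP (x \in A); last by rewrite cardsU1 xA setU1K // eqxx !andbT.
    rewrite andbF /=; apply/esym/negbTE; rewrite !negb_and; apply/orP; right.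
    by apply/eqP => e; move: xA; rewrite -e !inE eqxx.
  rewrite setU1K //; apply/negP => /(subsetP sA); by rewrite !inE eqxx.
apply: eq_bigr => A /andP[sA /eqP cA].
rewrite jt_peel; last by rewrite cA e0; lia.
rewrite !mulr_suml; apply: eq_bigr => x xA; rewrite /H setD1K //.
have -> : (D :\ x) :\: (A :\ x) = D :\: A.
  by apply/setP => i; rewrite !inE; case: eqVneq => [->|]; rewrite ?xA ?andbF ?andbT.
congr (_ / _ * _ * _ / _).
- by congr pole; rewrite cA e0; lia.
- by apply: eq_jt => i; rewrite eL /b1; lia.
- by apply: eq_jt => i; rewrite eR /b1; lia.
Qed.

End SubsetExpansion.

(** * Overlaps *)

Lemma jt_perm_rows (R : comNzRingType) p q (s : 'S_p) (B1 B2 : nat -> int) (g : int -> R) :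
  (forall i : 'I_p, B1 i = B2 (s i)) -> (forall j, (p <= j)%N -> B1 j = B2 j) ->
  jt (fun i : 'I_(p + q) => B1 i) g = (-1) ^+ s * jt (fun i : 'I_(p + q) => B2 i) g.
Proof.
move=> e1 e2; pose M B : 'M[R]_(p + q) := \matrix_(i, j) g (B (nat_of_ord i) + j%:Z).
(* The permutation moves only the first p rows, hence the block matrix with an identity block. *)
have -> : (-1) ^+ s = \det (block_mx (perm_mx s) 0 0 1%:M : 'M[R]_(p + q)).
  by rewrite det_ublock det_perm det1 mulr1.
rewrite -det_mulmx; congr (\det _).
rewrite -[X in _ *m X]vsubmxK mul_block_col !mul0mx addr0 add0r mul1mx -row_permE.
apply/matrixP => i j; case: (split_ordP i) => k ->.
  by rewrite col_mxEu !mxE /= e1.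
by rewrite col_mxEd !mxE /= e2 // leq_addr.
Qed.

Lemma size_add_rho a la : size (add_rho a la) = a.
Proof. exact: size_mkseq. Qed.

(** The sequence la + rho is strictly decreasing, so a sorting permutation exists and the default 1
    does not arise; every sorting permutation produces this same sequence. *)
Lemma overlap_signP (R : pzRingType) a b mu nu la : is_partition la ->
  perm_eq (add_rho (a + b) (firstparts (a + b) la)) (add_rho a mu ++ add_rho b nu) ->
  exists s : 'S_(a + b), overlap_sign R a b mu nu = (-1) ^+ s /\
    forall i : 'I_(a + b), (nth 0 la i + (a + b - i.+1))%N =
      nth 0%N (add_rho a mu ++ add_rho b nu) (s i).
Proof.
move=> pla; set u := add_rho a mu ++ add_rho b nu; set v := add_rho _ _ => puv.
have szu : size u == (a + b)%N by rewrite size_cat !size_add_rho.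
have nv (i : 'I_(a + b)) : nth 0%N v i = (nth 0 la i + (a + b - i.+1))%N.
  by rewrite !nth_mkseq.
have ev : v = [seq nth 0%N v (i : 'I_(a + b)) | i <- enum 'I_(a + b)].
  apply: (@eq_from_nth _ 0%N) => [|i]; rewrite size_add_rho.
    by rewrite size_map size_enum_ord.
  by move=> lt; rewrite (nth_map_ord (fun i : 'I__ => nth 0%N v i) (Ordinal lt)).
have srt : sorted gtn v.
  apply/(sortedP 0%N) => i; rewrite size_add_rho => lt.
  rewrite (nv (Ordinal lt)) (nv (Ordinal (ltnW lt))) /=.
  by have := partP _ pla i i.+1 (leqnSn i); lia.
have [s0 e0] : exists s0 : 'S_(a + b), v = [seq nth 0%N u (s0 i) | i <- enum 'I_(a + b)].
  have /tuple_permP[s0 e0] : perm_eq v (Tuple szu) by [].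
  exists s0; rewrite e0 /=; apply: eq_map => i; exact: tnth_nth.
rewrite /overlap_sign -/u; case: pickP => [s hs | /(_ s0)]; last by rewrite -e0 srt.
exists s; split=> // i; rewrite -nv.
suff -> : v = [seq nth 0%N u (s i) | i <- enum 'I_(a + b)].
  exact: (nth_map_ord (fun i : 'I__ => nth 0%N u (s i))).
apply: (@irr_sorted_eq _ gtn) => //.
- by move=> x y z /= h1 h2; exact: ltn_trans h2 h1.
- by move=> x; rewrite /= ltnn.
rewrite e0 => x; apply/mapP/mapP => -[j _ ->].
  by exists ((s^-1)%g (s0 j)); rewrite ?mem_enum // permKV.
by exists ((s0^-1)%g (s j)); rewrite ?mem_enum // permKV.
Qed.

(** If the bound failed, part n - k (at zero-based position p) would be below m - k. Then k < m and
    (m - k, n - k) is outside the diagram, so k + 1 would be admissible. *)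
Lemma index_bound m n la (k : int) : is_index m n la k ->
  [/\ k <= m%:Z, k <= n%:Z &
    forall p : nat, n%:Z - k = p.+1%:Z -> m%:Z - k <= (nth 0%N la p)%:Z].
Proof.
case=> /andP[]; rewrite le_min => /andP[km kn] _ hmax; split => // p ep.
rewrite leNgt; apply/negP => lt.
have : k + 1 <= k; last by lia.
apply: hmax; rewrite le_min; apply/andP; split; first by apply/andP; split; lia.
rewrite (_ : n%:Z + 1 - (k + 1) = p.+1%:Z); last by lia.
rewrite (_ : m%:Z + 1 - (k + 1) = m%:Z - k); last by lia.
case: (m%:Z - k) lt => // c lt; rewrite /= !negb_or /=; lia.
Qed.

(** * Complementary subsequences as subsets of indices *)

Section Masks.

Variables (T : eqType) (n : nat) (X : n.-tuple T).
Hypothesis uniqX : uniq X.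

Lemma mask_tuple (a : n.-tuple bool) :
  mask a X = [seq tnth X i | i <- enum [set i | tnth a i]].
Proof.
rewrite -{1}(map_tnth_enum X) -map_mask; congr map.
rewrite -[X in mask X](map_tnth_enum a) -filter_mask.
by rewrite enumT; apply: eq_filter => i; rewrite -[RHS]/(i \in [set j | tnth a j]) inE.
Qed.

(** Masks are index sets, and since [X] has distinct entries the reordering condition forces the
    second set to be the complement of the first. *)
Lemma sum_complementary_masks (V : nmodType) l (G : seq T -> seq T -> V) :
  \sum_(a : n.-tuple bool) \sum_(b : n.-tuple bool |
      [&& size (mask a X) == l, size (mask b X) == (n - l)%N
        & perm_eq (mask a X ++ mask b X) X]) G (mask a X) (mask b X)
  = \sum_(A : {set 'I_n} | #|A| == l)
      G [seq tnth X i | i <- enum A] [seq tnth X i | i <- enum (~: A)].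
Proof.
pose ind (A : {set 'I_n}) : n.-tuple bool := [tuple i \in A | i < n].
have indK A : [set i | tnth (ind A) i] = A.
  by apply/setP => i; rewrite inE tnth_mktuple.
have setK (a : n.-tuple bool) : ind [set i | tnth a i] = a.
  by apply: eq_from_tnth => i; rewrite tnth_mktuple inE.
have injX : injective (tnth X) by apply/tuple_uniqP.
rewrite (reindex_onto ind (fun a => [set i | tnth a i])) // [RHS]big_mkcond.
apply: eq_big => [A|A _]; first by rewrite indK eqxx.
rewrite (reindex_onto ind (fun a => [set i | tnth a i])) //.
rewrite (eq_bigl (fun B => (#|A| == l) && (B == ~: A))) => [|B].
  case: ifP => _; last by rewrite big_pred0.
  by rewrite big_pred1_eq !mask_tuple !indK.
rewrite !mask_tuple !indK eqxx andbT !size_map -!cardE -map_cat.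
case: eqP => //= cA.
apply/andP/eqP => [[_]|->].
  rewrite -(map_tnth_enum X) => /(perm_map_inj injX) pAB.
  have uAB : uniq (enum A ++ enum B) by rewrite (perm_uniq pAB) enum_uniq.
  move: uAB; rewrite cat_uniq => /and3P[_ /hasPn dAB _].
  apply/setP => i; rewrite inE; have := perm_mem pAB i.
  rewrite mem_cat !mem_enum; case: (boolP (i \in A)) => iA /=; last by move->.
  move=> _; apply/negbTE/negP => iB; have := dAB i.
  by rewrite !mem_enum => /(_ iB); rewrite iA.
split; first by rewrite cardsCs setCK card_ord cA.
rewrite -(map_tnth_enum X); apply: perm_map; apply: uniq_perm.
- rewrite cat_uniq !enum_uniq andbT /=; apply/hasPn => i.
  by rewrite !mem_enum inE.
- exact: enum_uniq.
by move=> i; rewrite mem_cat !mem_enum inE orbN.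
Qed.

End Masks.

Theorem theorem3p3 (F : fieldType) (n m : nat) (X : n.-tuple F) (Y : m.-tuple F)
    (uniqX : uniq X) (la : seq nat) (part_la : is_partition la)
    (k : int) (idx_k : is_index m n la k) :
  let p : nat := absz (n%:Z - k)%R in (* p = n - k, which is nonnegative *)
  forall (l : nat) (le_l : l%:Z <= Order.min (n%:Z - k) n%:Z)
    (mu nu : seq nat) (part_mu : is_partition mu) (part_nu : is_partition nu)
    (len_mu : (plength mu <= l)%N) (len_nu : (plength nu <= p - l)%N)
    (ov : is_overlap l (p - l) mu nu (firstparts p la)),
  LS la (map -%R X) Y =
  \sum_(a : n.-tuple bool)
    \sum_(b : n.-tuple bool |
           [&& size (mask a X) == l, size (mask b X) == (n - l)%N
             & perm_eq (mask a X ++ mask b X) X])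
      let S := mask a X in
      let T := mask b X in
      overlap_sign F l (p - l) mu nu
      * LS (add_rect l mu k) (map -%R S) Y
      * LS (firstparts (p - l) nu ++ drop p la) (map -%R T) Y
      / cross_diff T S.
Proof.
move=> p l le_l mu nu part_mu part_nu _ _ [_ _ puv].
have [km kn kbound] := index_bound idx_k.
have ep : p%:Z = n%:Z - k by rewrite /p; lia.
have lelp : (l <= p)%N by move: le_l; rewrite le_min -ep => /andP[].
rewrite -[p in firstparts p la](subnKC lelp) in puv.
rewrite (sum_complementary_masks uniqX l (fun S T => overlap_sign F l (p - l) mu nu
      * LS (add_rect l mu k) (map -%R S) Y
      * LS (firstparts (p - l) nu ++ drop p la) (map -%R T) Y
      / cross_diff T S)).
clearbody p.
have [b epb] : exists b, p = (l + b)%N by exists (p - l)%N; rewrite subnKC.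
subst p; rewrite addKn in puv *.
have [s [-> es]] := overlap_signP F part_la puv.
set u := add_rho l mu ++ add_rho b nu in es.
(* With q further rows, the determinant has room for all parts of [la] after the first n - k. *)
pose q := size la.
have injX : injective (tnth X) by apply/tuple_uniqP.
have ul i : (i < l)%N -> nth 0%N u i = (nth 0 mu i + (l - i.+1))%N.
  by move=> lt; rewrite nth_cat size_add_rho lt nth_mkseq.
have ub j : (j < b)%N -> nth 0%N u (l + j) = (nth 0 nu j + (b - j.+1))%N.
  by move=> lt; rewrite nth_cat size_add_rho ltnNge leq_addr /= addKn nth_mkseq.
have ue i : (i < l + b)%N -> exists i' : 'I_(l + b),
    nth 0%N u i = (nth 0 la i' + (l + b - i'.+1))%N.
  move=> lt; exists ((s^-1)%g (Ordinal lt)).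
  by rewrite es permKV.
have la_ge (i : 'I_(l + b)) : m%:Z - k <= (nth 0%N la i)%:Z.
  have [c ec] : exists c, (l + b = c.+1)%N by exists (l + b).-1; have := ltn_ord i; lia.
  have epc : n%:Z - k = c.+1%:Z by rewrite -ep ec.
  apply: le_trans (kbound c epc) _.
  by rewrite lez_nat; apply: (partP _ part_la); have := ltn_ord i; lia.
(* Row labels in the order of [u]: with p = l + b, the label la_i - i is la_i + (p - i - 1) - (p -
   1), hence the shift by p - 1. *)
pose B (i : nat) : int := if (i < l + b)%N then (nth 0%N u i)%:Z - (l + b)%:Z + 1
                          else (nth 0%N la i)%:Z - i%:Z.
(* The geometric range demanded by [jt_split]: a sorted label is some la_i' - i' with la_i' >= m - k
   and i' < n - k. *)
have Bge i : (i < l + b)%N -> m%:Z <= B i + n%:Z - 1.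
  move=> lt; rewrite /B lt; have [i' ->] := ue i lt.
  by have := la_ge i'; have := ltn_ord i'; lia.
(* The absolute value in [add_rect] is harmless: the label of row l - 1 gives mu_(l-1) + k >= m, and
   the other parts of [mu] are no smaller. *)
have muk i : (i < l)%N -> 0 <= (nth 0%N mu i)%:Z + k.
  move=> lt; have lt' : (l.-1 < l + b)%N by lia.
  have := Bge _ lt'; rewrite /B lt' ul; last by lia.
  have := partP _ part_mu i l.-1; lia.
have pS : is_partition (add_rect l mu k).
  apply/partP => i j ij; have [lt|ge] := ltnP j l; last first.
    by rewrite (nth_default _ (_ : size _ <= j)%N) ?size_mkseq.
  have lt' := leq_ltn_trans ij lt; rewrite !nth_mkseq //.
  by have := partP _ part_mu i j ij; have := muk i lt'; have := muk j lt; lia.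
pose ka := firstparts b nu ++ drop (l + b) la.
have nka i : nth 0%N ka i = if (i < b)%N then nth 0%N nu i else nth 0%N la (l + i)%N.
  rewrite nth_cat size_mkseq; case: ltnP => lt; first by rewrite nth_mkseq.
  by rewrite nth_drop -addnA subnKC.
have pT : is_partition ka.
  apply/partP => i j ij; rewrite !nka.
  case: (ltnP j b) => jb; first by rewrite (leq_ltn_trans ij jb) (partP _ part_nu).
  case: (ltnP i b) => ib; last by rewrite (partP _ part_la) // leq_add2l.
  (* The last entry of [nu] equals some la_i' + p - i' - 1, hence is at least la_i' and so at least
     every part of [la] after position p. *)
  have lt : (l + b.-1 < l + b)%N by lia.
  have := partP _ part_nu i b.-1; have [i' e] := ue _ lt.
  rewrite ub in e; last by lia.
  have := partP _ part_la i' (l + j)%N; have := ltn_ord i'.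
  by move: e; lia.
rewrite LS_jtp // -(@jtpE _ (l + b + q)) ?ls_series0 //; last first.
- by rewrite (leq_trans (count_size _ _)) // leq_addl.
- exact: causal_ls.
rewrite -[LHS]/(jt (fun i : 'I_(l + b + q) => (nth 0%N la i)%:Z - i%:Z) _).
rewrite (@jt_perm_rows _ _ _ s (fun i => (nth 0%N la i)%:Z - i%:Z) B); first last.
- by move=> j; rewrite /B ltnNge => ->.
- by move=> i; rewrite /B ltn_ord -es; have := ltn_ord i; lia.
rewrite -addnA.
have -> : ls_series (map -%R X) Y = ls_set Y (tnth X) setT.
  by rewrite /ls_set enum_setT -enumT -{1}(map_tnth_enum X) -map_comp.
rewrite jt_split // => [|i]; last first.
  by rewrite cardsT card_ord size_tuple Bge //=; have := ltn_ord i; lia.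
rewrite mulr_sumr; apply: eq_big => [A|A _]; first by rewrite subsetT.
rewrite !mulrA setTD cardsT card_ord -!map_comp.
rewrite !LS_jtp //.
congr (_ * _ * _ / _).
(* The shift by n - l turns the labels of [mu] into mu_i + k - i, which adds the rectangle. *)
- rewrite -(@jtpE _ l) ?ls_series0 //; last first.
  + by rewrite (leq_trans (count_size _ _)) // size_mkseq.
  + exact: causal_ls.
  apply: eq_jt => i; have lt := ltn_ord i.
  have lt' : (i < l + b)%N by lia.
  rewrite /beta nth_mkseq // /= /B lt' ul //.
  by have := muk i lt; lia.
(* The shift by l makes the labels nu_i - i for i < b, and la_(l+i) - i afterwards. *)
- rewrite -(@jtpE _ (b + q)) ?ls_series0 //; last first.
  + rewrite (leq_trans (count_size _ _)) // size_cat size_mkseq size_drop.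
    by rewrite leq_add2l leq_subr.
  + exact: causal_ls.
  apply: eq_jt => i; rewrite /beta nka /= /B ltn_add2l.
  by case: ltnP => lt; rewrite ?ub //; lia.
rewrite /cross_diff big_map big_enum; apply: eq_big => // t _.
by rewrite big_map big_enum.
Qed.
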